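(* Let $Y \subseteq \widehat{A}$ be a closed, $\Theta$-invariant set such that $Y(1) = \{\chi(1) : \chi \in Y\}$ is not all of $\mathbb{T}$. Then $Y$ is contained in a set of the form $$ U = \bigcup_{i=1}^k \overline{B}^{\mathbb{C}}_{1/2}(u_i) $$ where $u_1, \dots, u_k$ is a finite collection of torsion points of $\widehat{A}$.
   Context: Let $\mathcal{P}_5 = 1+2i$, $\mathcal{P}_{13} = 2+3i$, $\theta_5 = \mathcal{P}_5/\overline{\mathcal{P}_5}$, $\theta_{13} = \mathcal{P}_{13}/\overline{\mathcal{P}_{13}}$. Let $A = \mathbb{Z}[i][1/\overline{\mathcal{P}_5}, 1/\overline{\mathcal{P}_{13}}] \subset \mathbb{Q}(i)$, and let $\Theta = \{ \theta_5^r \theta_{13}^s : r, s \in \mathbb{Z}_{\ge 0} \} \subset A$, a multiplicative semigroup. Let $\mathbb{T} = \mathbb{R}/\mathbb{Z}$, and let $\widehat{A}$ be the Pontryagin dual of the discrete additive group $A$, i.e. the group of all homomorphisms $\chi : A \to \mathbb{T}$ with the topology of pointwise convergence; it is a compact metrizable abelian group. The semigroup $\Theta$ acts on $\widehat{A}$ by $(\theta(\chi))(a) = \chi(\theta a)$. A set $Y \subseteq \widehat{A}$ is $\Theta$-invariant if $\theta(\chi) \in Y$ for all $\theta \in \Theta$, $\chi \in Y$. Define $\jmath_{\mathbb{C}} : \mathbb{C} \to \widehat{A}$ by $\jmath_{\mathbb{C}}(z)(a) = \mathrm{Re}(za) \ (\mathrm{mod}\ 1)$. For $x \in \widehat{A}$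 and $R>0$, $\overline{B}^{\mathbb{C}}_R(x) = \{ x + \jmath_{\mathbb{C}}(z) : z \in \mathbb{C},\ |z| \le R \}$. *)

(* Defs.v *)
From HB Require Import structures.
From mathcomp Require Import all_boot all_order all_algebra.
From mathcomp Require Import generic_quotient ring_quotient.
From mathcomp Require Import all_classical all_reals all_analysis.
From mathcomp Require Import complex.

Set Implicit Arguments.
Unset Strict Implicit.
Unset Printing Implicit Defensive.

Import Order.TTheory GRing.Theory Num.Theory.
Import numFieldNormedType.Exports.

Local Open Scope classical_set_scope.
Local Open Scope complex_scope.
Local Open Scope quotient_scope.
Local Open Scope ring_scope.

Section Circle.
Variable R : realType.

Definition int_sub : {pred R} := fun x => x \is a Num.int.

Fact int_sub_zmod_closed : zmod_closed int_sub.
Proof.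
split; first exact: int_num0.
move=> x y xZ yZ; change ((x - y) \is a Num.int).
by apply: rpredB; [exact: xZ | exact: yZ].
Qed.
HB.instance Definition _ := GRing.isZmodClosed.Build R int_sub
  int_sub_zmod_closed.

Definition circle : Type := Quotient.quot int_sub.
HB.instance Definition _ := ZmodQuotient.on circle.
HB.instance Definition _ := GRing.Zmodule.on circle.

(* The opens are those of [quotient_topology circle]; that type cannot be used
   directly because its choice structure differs from the one underlying the
   group structure of [circle]. *)
Definition circle_open (U : set circle) : Prop := open (\pi_circle @^-1` U).

Fact circle_openT : circle_open [set: circle].
Proof. exact: (@openT (quotient_topology circle)). Qed.
Fact circle_openI (U V : set circle) :
  circle_open U -> circle_open V -> circle_open (U `&` V).
Proof. exact: (@openI (quotient_topology circle)). Qed.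
Fact circle_open_bigcup (I : Type) (U : I -> set circle) :
  (forall i, circle_open (U i)) -> circle_open (\bigcup_i U i).
Proof.
by move=> oU; apply: (@bigcup_open (quotient_topology circle)) => i _; apply: oU.
Qed.
HB.instance Definition _ := isOpenTopological.Build circle
  circle_openT circle_openI circle_open_bigcup.
End Circle.

Section PontryaginDual.
Variables (R : realType) (A : zmodType).

(* Pontryagin dual of [A] taken with the discrete topology. *)
Definition pdual : Type := {additive A -> circle R}.
HB.instance Definition _ := gen_eqMixin pdual.
HB.instance Definition _ := gen_choiceMixin pdual.

Implicit Types chi psi : pdual.

Lemma pdual_ext chi psi : chi =1 psi -> chi = psi.
Proof.
case: chi psi => [f [[f_add]]] [g [[g_add]]] /= /funext fg.
by case: _ / fg g_add => g_add; rewrite (Prop_irrelevance f_add g_add).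
Qed.

Definition pdual0 : pdual := (\0 : A -> circle R) : {additive A -> circle R}.
Definition pdualN chi : pdual := (\- chi) : {additive A -> circle R}.
Definition pdualD chi psi : pdual := (chi \+ psi) : {additive A -> circle R}.

Fact pdualDA : associative pdualD.
Proof. by move=> f g h; apply: pdual_ext => a; exact: addrA. Qed.
Fact pdualDC : commutative pdualD.
Proof. by move=> f g; apply: pdual_ext => a; exact: addrC. Qed.
Fact pdual0D : left_id pdual0 pdualD.
Proof. by move=> f; apply: pdual_ext => a; exact: add0r. Qed.
Fact pdualND : left_inverse pdual0 pdualN pdualD.
Proof. by move=> f; apply: pdual_ext => a; exact: addNr. Qed.
HB.instance Definition _ :=
  GRing.isZmodule.Build pdual pdualDA pdualDC pdual0D pdualND.

Definition pdual_ptws chi : {ptws A -> circle R} := chi.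
HB.instance Definition _ :=
  Topological.copy pdual (initial_topology pdual_ptws).
End PontryaginDual.

Section GaussianRing.
Variable R : realType.

Definition gaussian : {pred R[i]} :=
  fun z => (complex.Re z \is a Num.int) && (complex.Im z \is a Num.int).

Fact gaussian_subring_closed : subring_closed gaussian.
Proof.
split.
- by apply/andP; split; [exact: int_num1 | exact: int_num0].
- move=> [a b] [c d] /andP[/= aZ bZ] /andP[/= cZ dZ].
  by apply/andP; split; apply: rpredB.
- move=> [a b] [c d] /andP[/= aZ bZ] /andP[/= cZ dZ].
  by apply/andP; split; [apply: rpredB | apply: rpredD]; apply: rpredM.
Qed.
HB.instance Definition _ := GRing.isSubringClosed.Build R[i] gaussian
  gaussian_subring_closed.

Definition P5 : R[i] := 1 +i* 2.
Definition P13 : R[i] := 2 +i* 3.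

(* Z[i][1/P5^*, 1/P13^*] as the localization of Z[i], inside R[i]. *)
Definition locZi : {pred R[i]} := fun a =>
  `[< exists g m n, g \in gaussian /\ a = g / (P5^* ^+ m * P13^* ^+ n) >].

Lemma P5_conj_neq0 : P5^* != 0.
Proof. by rewrite eq_complex /= oner_eq0. Qed.
Lemma P13_conj_neq0 : P13^* != 0.
Proof. by rewrite eq_complex /= pnatr_eq0. Qed.

Lemma P5_conj_gaussian : P5^* \in gaussian.
Proof. by apply/andP; split=> /=; rewrite ?rpredN ?rpred1 ?rpred_nat. Qed.
Lemma P13_conj_gaussian : P13^* \in gaussian.
Proof. by apply/andP; split=> /=; rewrite ?rpredN ?rpred1 ?rpred_nat. Qed.
Lemma P5_gaussian : P5 \in gaussian.
Proof. by apply/andP; split=> /=; rewrite ?rpred1 ?rpred_nat. Qed.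
Lemma P13_gaussian : P13 \in gaussian.
Proof. by apply/andP; split=> /=; rewrite ?rpred1 ?rpred_nat. Qed.

Fact locZi_subring_closed : subring_closed locZi.
Proof.
have nz m n : P5^* ^+ m * P13^* ^+ n != 0.
  by rewrite mulf_neq0 // expf_neq0 ?P5_conj_neq0 ?P13_conj_neq0.
have nzG m n : P5^* ^+ m * P13^* ^+ n \in gaussian.
  by apply: rpredM; apply: rpredX;
    [exact: P5_conj_gaussian | exact: P13_conj_gaussian].
split.
- apply/asboolP; exists 1, 0%N, 0%N; split; first exact: rpred1.
  by rewrite !expr0 mulr1 divr1.
- move=> _ _ /asboolP[g [m [n [gG ->]]]] /asboolP[h [p [q [hG ->]]]].
  apply/asboolP.
  exists (g * (P5^* ^+ p * P13^* ^+ q) - h * (P5^* ^+ m * P13^* ^+ n)),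
    (m + p)%N, (n + q)%N; split.
    by apply: rpredB; apply: rpredM.
  by rewrite !exprD [X in _ = _ / X]mulrACA -mulNr addf_div // mulNr.
- move=> _ _ /asboolP[g [m [n [gG ->]]]] /asboolP[h [p [q [hG ->]]]].
  apply/asboolP; exists (g * h), (m + p)%N, (n + q)%N; split.
    exact: rpredM.
  by rewrite !exprD [X in _ = _ / X]mulrACA mulf_div.
Qed.
HB.instance Definition _ := GRing.isSubringClosed.Build R[i] locZi
  locZi_subring_closed.

Record ringA : Type := RingA { ringA_val : R[i]; _ : ringA_val \in locZi }.
HB.instance Definition _ := [isSub for ringA_val].
HB.instance Definition _ := [Choice of ringA by <:].
HB.instance Definition _ := [SubChoice_isSubComNzRing of ringA by <:].

Fact theta5_locZi : P5 / P5^* \in locZi.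
Proof.
apply/asboolP; exists P5, 1%N, 0%N; split; first exact: P5_gaussian.
by rewrite expr0 expr1 mulr1.
Qed.
Fact theta13_locZi : P13 / P13^* \in locZi.
Proof.
apply/asboolP; exists P13, 0%N, 1%N; split; first exact: P13_gaussian.
by rewrite expr0 expr1 mul1r.
Qed.

Definition theta5 : ringA := RingA theta5_locZi.
Definition theta13 : ringA := RingA theta13_locZi.
Definition Theta : set ringA :=
  [set t | exists r s : nat, t = theta5 ^+ r * theta13 ^+ s].

Definition hatA : Type := pdual R ringA.
HB.instance Definition _ := GRing.Zmodule.on hatA.
HB.instance Definition _ := Topological.on hatA.

Implicit Types (t a : ringA) (chi : hatA).

Fact act_is_zmod_morphism t chi : zmod_morphism (fun a => chi (t * a)).
Proof. by move=> a b; rewrite mulrBr raddfB. Qed.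
Definition act t chi : hatA :=
  HB.pack (fun a => chi (t * a))
    (GRing.isZmodMorphism.Build _ _ _ (act_is_zmod_morphism t chi)).

Definition Theta_invariant (Y : set hatA) : Prop :=
  forall t chi, Theta t -> Y chi -> Y (act t chi).

Fact jC_is_zmod_morphism (z : R[i]) :
  zmod_morphism (fun a => \pi_(circle R) (complex.Re (z * val a))).
Proof. by move=> a b; rewrite raddfB mulrBr raddfB /= raddfB. Qed.
Definition jC (z : R[i]) : hatA :=
  HB.pack (fun a : ringA => \pi_(circle R) (complex.Re (z * val a)))
    (GRing.isZmodMorphism.Build _ _ _ (jC_is_zmod_morphism z)).

Definition cballC (r : R) (x : hatA) : set hatA :=
  [set x + jC z | z in [set z : R[i] | `|z| <= r%:C]].

Definition torsion (x : hatA) : Prop := exists2 n, (0 < n)%N & x *+ n = 0.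
End GaussianRing.

(* Main.v *)
Require Import Defs.
From HB Require Import structures.
From mathcomp Require Import all_boot all_order all_algebra.
From mathcomp Require Import generic_quotient ring_quotient finmap cyclic.
From mathcomp Require Import all_classical all_reals all_analysis.
From mathcomp Require Import complex.
From mathcomp Require Import zify ring lra.

(** The dual of [A] is a solenoid: [jC C] is a dense complex line in it, the
    transversals to this line are products of 5-adic and 13-adic discs, and [Theta]
    rotates the line while it expands the transversals. The proof is a version of
    Furstenberg's argument for multiplication by 2 and 3 on the circle, in the
    elementary form due to Boshernitzan, in which the line plays the role of a
    neutral direction. No completion is used. Let [D] be the product of the two
    inverted primes. Then [A] is the union of the lattices [D ^- c Z[i]], every
    character agrees on each of them with some [jC z], where [z] is unique modulo
    [D ^+ c Z[i]], and these local coordinates describe the topology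
    ([nbhs_hatAP]).

    The main step is [invariant_full]: a closed set [Q] that is invariant under
    [N]-th powers of [Theta] and accumulates at [0] outside [jC C] is everything. A
    point of [Q] near [0] and outside the line has, on a deep lattice, the
    coordinate [z + kappa] with [z] small and [kappa] a Gaussian integer that is
    divisible by a high power of [D], but not by arbitrarily high ones. By symmetry
    suppose that this concerns the prime above 5. Powers of [theta5] lower the
    valuation of [kappa] to a prescribed negative range, and powers of [theta13]
    then act as powers of a fixed unit of [Z/5^L], which fill a whole class modulo a
    power of 5 that is independent of [L]. The orbit thus meets every cell of a
    lattice of small mesh ([orbit_dense]).

    This is used twice. First, if a nonempty closed invariant set has no point of
    [torsion + jC C], then the differences of its points exhaust the dual, and it
    contains progressions with a prescribed step of order [2 ^ k]
    ([torsion_progression]); its values at [1] are then dense. Second, if [Y]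
    accumulates at a point [u + jC z], with [u] torsion, outside [u + jC C], then the
    differences between [Y] and a disc exhaust the dual, and an irrational
    rotation of [z] shows again that [Y(1)] is dense ([accumulation_hits]).

    When [Y(1)] omits an arc, both conclusions are excluded. Hence every point of
    [Y] has the form [u + jC z] with [u] torsion ([all_on_torsion_lines]), and [Y]
    stays locally on single lines [u + jC C], so that finitely many [u] suffice by compactness.
    Finally, the real parts of the rotated [z] are dense in [[- |z|, |z|]], an
    interval that covers the circle if [|z| >= 1/2]; hence [|z| <= 1/2]
    ([radius_le_half]). *)

Set Implicit Arguments.
Unset Strict Implicit.
Unset Printing Implicit Defensive.

Import Order.TTheory GRing.Theory Num.Theory.
Import numFieldNormedType.Exports.

Local Open Scope classical_set_scope.
Local Open Scope ring_scope.

(** * Powers of an integer modulo powers of an odd prime *)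

Section PowersModPrime.
Local Open Scope nat_scope.
Variable p : nat.
Hypotheses (p_pr : prime p) (p_odd : odd p).

(** Raising to the power [p] increases the valuation of [h - 1] by exactly one,
    when it is positive and [p] is odd. *)
Lemma exp_prime_lift k b : 0 < k -> ~~ (p %| b) ->
  exists2 b', ~~ (p %| b') & (1 + p ^ k * b) ^ p = 1 + p ^ k.+1 * b'.
Proof.
move=> k_gt0 pNb; set y := p ^ k * b.
have p_gt2 : 2 < p by apply: odd_prime_gt2.
have py : p %| y by rewrite dvdn_mulr // dvdn_exp.
(* [p] divides the middle binomial coefficients, and [y ^ (p - 2)] since [p > 2]. *)
have [c cE] : exists c, (1 + y) ^ p = 1 + p * y + p * y ^ 2 * c.
  have pC i : 2 <= i <= p -> p %| 'C(p, i) * y ^ (i - 2).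
    move=> /andP[i2]; rewrite leq_eqVlt => /orP[/eqP ->|ip].
      by apply/dvdn_mull/(dvdn_trans py)/dvdn_exp; rewrite ?subn_gt0.
    by apply/dvdn_mulr/prime_dvd_bin => //; lia.
  exists (\sum_(2 <= i < p.+1) ('C(p, i) * y ^ (i - 2)) %/ p).
  rewrite expnDn; under [LHS]eq_bigr => i _ do rewrite exp1n mul1n.
  rewrite -(big_mkord xpredT (fun i => 'C(p, i) * y ^ i)).
  rewrite big_ltn // big_ltn ?ltnS 1?ltnW ?(ltnW p_gt2) //=.
  rewrite bin0 bin1 expn0 expn1 mul1n addnA; congr (_ + _).
  rewrite big_distrr /= [LHS]big_seq [RHS]big_seq; apply: eq_bigr => i.
  rewrite mem_index_iota ltnS => ip.
  have i2 : 2 <= i by case/andP: ip.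
  have -> : y ^ i = y ^ 2 * y ^ (i - 2) by rewrite -expnD subnKC.
  by rewrite mulnCA -{1}(divnK (pC i ip)) [_ * p]mulnC mulnCA mulnA.
exists (b * (1 + y * c)); last by rewrite cE (expnS p k) /y; move: (p ^ k) => q; ring.
rewrite Euclid_dvdM // negb_or pNb /= dvdn_addl; first by rewrite Euclid_dvd1.
by rewrite dvdn_mulr.
Qed.

Lemma exp_prime_pow_lift k b j : 0 < k -> ~~ (p %| b) ->
  exists2 b', ~~ (p %| b') & (1 + p ^ k * b) ^ (p ^ j) = 1 + p ^ (k + j) * b'.
Proof.
move=> k_gt0 pNb; elim: j => [|j [b' pNb' IH]]; first by exists b; rewrite ?addn0.
have kj_gt0 : 0 < k + j by rewrite addn_gt0 k_gt0.
have [b'' pNb'' E] := exp_prime_lift kj_gt0 pNb'.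
by exists b''; rewrite ?addnS // expnSr expnM IH.
Qed.

(** The powers of an integer [h = 1 mod p] that is not [1 mod p ^ E] fill the
    subgroup [1 + p ^ E Z] of the units modulo every power of [p]. *)
Lemma powers_cover E h L x :
    h = 1 %[mod p] -> h <> 1 %[mod p ^ E] -> x = 1 %[mod p ^ E] ->
  exists2 s, s < p ^ L & h ^ s = x %[mod p ^ L].
Proof.
move=> h1 hNE xE.
have p_gt1 := prime_gt1 p_pr.
have h_gt0 : 0 < h.
  by case: h h1 {hNE} => // /eqP; rewrite eq_sym eqn_mod_dvd // subn0 Euclid_dvd1.
have h_gt1 : 1 < h by rewrite ltn_neqAle h_gt0 andbT; apply: contra_notN hNE => /eqP <-.
have h1_gt0 : 0 < h - 1 by rewrite subn_gt0.
have p_h1 : p %| h - 1 by rewrite -eqn_mod_dvd //; apply/eqP.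
have [k [b [k_gt0 pNb hE kE]]] : exists k b,
    [/\ 0 < k, ~~ (p %| b), h = 1 + p ^ k * b & k < E].
  exists (logn p (h - 1)), ((h - 1) %/ p ^ logn p (h - 1)); split.
  - by rewrite logn_gt0 mem_primes p_pr h1_gt0.
  - rewrite -{1}(expn1 p) dvdn_divRL ?pfactor_dvdnn // -expnD add1n.
    by rewrite pfactor_dvdn // ltnn.
  - by rewrite mulnC divnK ?pfactor_dvdnn // subnKC.
  - rewrite ltnNge; apply: contra_notN hNE => le; apply/eqP.
    by rewrite eqn_mod_dvd // pfactor_dvdn.
suff [s hs] : exists s, h ^ s = x %[mod p ^ L].
  exists (s %% p ^ L); first by rewrite ltn_mod expn_gt0 prime_gt0.
  have [b' _] := exp_prime_pow_lift L k_gt0 pNb; rewrite -hE => hL.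
  have hL1 : h ^ (p ^ L) = 1 %[mod p ^ L].
    by rewrite hL expnD mulnAC addnC modnMDl.
  rewrite -hs {2}(divn_eq s (p ^ L)) expnD [_ * p ^ L]mulnC expnM.
  set q := s %/ _; have hq : (h ^ (p ^ L)) ^ q = 1 %[mod p ^ L].
    by rewrite -modnXm hL1 modnXm exp1n.
  by rewrite -[RHS]modnMml hq modnMml mul1n.
have base L' : L' <= E -> exists s, h ^ s = x %[mod p ^ L'].
  move=> L'E; exists 0; rewrite expn0; apply/esym.
  have /dvdnP[q qE] := dvdn_exp2l p L'E.
  by rewrite -(modn_dvdm x (dvdn_exp2l p L'E)) xE modn_dvdm // dvdn_exp2l.
(* A solution [s] modulo [p ^ L] is corrected by a multiple [p ^ (L - k) * t], which
   changes [h ^ s] by [p ^ L * (h ^ s * b' * t)] modulo [p ^ L.+1]. *)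
elim: L => [|L [s hs]]; first exact: base.
have [/base//|EL] := leqP L.+1 E; rewrite ltnS in EL.
have [c cE] : exists c, h ^ s + p ^ L * c = x %[mod p ^ L.+1].
  have le : h ^ s <= x + p ^ L.+1 * h ^ s.
    by apply/(leq_trans _ (leq_addl _ _))/leq_pmull; rewrite expn_gt0 prime_gt0.
  exists ((x + p ^ L.+1 * h ^ s - h ^ s) %/ p ^ L).
  rewrite [p ^ L * _]mulnC divnK ?subnKC //; last first.
    rewrite -eqn_mod_dvd // expnSr addnC -mulnA [_ * (p * _)]mulnC.
    by rewrite modnMDl hs.
  by rewrite addnC mulnC modnMDl.
have [b' pNb'] := exp_prime_pow_lift (L - k) k_gt0 pNb; rewrite -hE.
rewrite (subnKC (ltnW (leq_trans kE EL))) => hL.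
have cop : coprime (h ^ s * b') p.
  rewrite coprime_sym prime_coprime // Euclid_dvdM // negb_or pNb' andbT.
  rewrite Euclid_dvdX // negb_and; apply/orP; left.
  by rewrite hE addnC dvdn_addr ?Euclid_dvd1 // dvdn_mulr // dvdn_exp.
have [t tE] : exists t, h ^ s * b' * t = c %[mod p].
  have [|u v uE _ ] := egcdnP p (m := h ^ s * b').
    by rewrite muln_gt0 expn_gt0 h_gt0 lt0n; apply: contraNneq pNb' => ->.
  exists (u * c); rewrite mulnA [_ * u]mulnC uE (eqP cop).
  by rewrite mulnDl mul1n mulnAC modnMDl.
exists (s + p ^ (L - k) * t); rewrite -cE expnD expnM hL.
have [d dE] : exists d, (1 + p ^ L * b') ^ t = 1 + p ^ L * b' * t + p ^ L.+1 * d.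
  elim: t {tE} => [|t [d IH]]; first by exists 0; rewrite !muln0.
  have L_gt0 : 0 < L by rewrite (leq_trans _ EL) // (leq_trans _ kE).
  exists (d + p ^ L.-1 * b' * b' * t + d * p ^ L * b').
  have -> : p ^ L.+1 = p * p ^ L by rewrite expnS.
  have -> : (1 + p ^ L * b') ^ t.+1 = (1 + p ^ L * b') ^ t * (1 + p ^ L * b').
    by rewrite expnSr.
  have pLE : p ^ L = p * p ^ L.-1 by rewrite -expnS prednK.
  rewrite IH expnS pLE; move: (p ^ L.-1) => q; ring.
rewrite dE.
have {}tE : p ^ L * (h ^ s * b' * t) = p ^ L * c %[mod p ^ L.+1].
  by rewrite expnSr -!muln_modr tE.
have -> : h ^ s * (1 + p ^ L * b' * t + p ^ L.+1 * d) =
  h ^ s * d * p ^ L.+1 + (h ^ s + p ^ L * (h ^ s * b' * t)).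
  by move: (p ^ L) (p ^ L.+1) (h ^ s) => q q' q''; ring.
by rewrite modnMDl -modnDmr tE modnDmr.
Qed.

End PowersModPrime.

(** * Divisibility in the Gaussian integers *)

Section GaussianDivisibility.
Local Open Scope complex_scope.
Local Open Scope ring_scope.
Variable R : realType.
Local Notation C := R[i].
Local Notation "'ZI'" := (@gaussian R).

Lemma gaussian_int (z : int) : z%:~R \in ZI.
Proof. by rewrite rpred_int. Qed.

Lemma gaussian_i : 'i%C \in ZI.
Proof. by rewrite unfold_in /= int_num0 int_num1. Qed.

Lemma gaussianP (g : C) : g \in ZI ->
  exists x y : int, g = x%:~R + y%:~R * 'i%C.
Proof.
case: g => a b /andP[/= /intrP[x ->] /intrP[y ->]]; exists x, y.
rewrite -[x%:~R + _]/(_ : C) -!(rmorph_int (@real_complex_def R (Phant R))).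
by apply/eqP; rewrite eq_complex /= !(mul0r, mulr0, mulr1, subr0, addr0, add0r) !eqxx.
Qed.

Lemma gaussian_norm (g : C) : g \in ZI -> exists n : nat, g * g^* = n%:R.
Proof.
case: g => a b /andP[/= /intrP[x ->] /intrP[y ->]].
exists (absz (x ^+ 2 + y ^+ 2)%R).
have -> : ((absz (x ^+ 2 + y ^+ 2)%R)%:R : C) = (x ^+ 2 + y ^+ 2)%:~R.
  by rewrite -[X in _ = X%:~R]gez0_abs ?addr_ge0 ?sqr_ge0.
rewrite -(rmorph_int (@real_complex_def R (Phant R))).
apply/eqP; rewrite eq_complex /= rmorphD /= !rmorphXn /=.
by apply/andP; split; apply/eqP; ring.
Qed.

(** [d] divides [g] with a quotient in [Z[i]]; [d] is an arbitrary complex number. *)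
Definition gdvd (d g : C) : Prop := exists2 h, h \in ZI & g = d * h.

Lemma gdvd0 d : gdvd d 0.
Proof. by exists 0; rewrite ?rpred0 ?mulr0. Qed.
Lemma gdvdD d a b : gdvd d a -> gdvd d b -> gdvd d (a + b).
Proof. by move=> [h hZ ->] [k kZ ->]; exists (h + k); rewrite ?rpredD ?mulrDr. Qed.
Lemma gdvdN d a : gdvd d a -> gdvd d (- a).
Proof. by move=> [h hZ ->]; exists (- h); rewrite ?rpredN ?mulrN. Qed.
Lemma gdvdB d a b : gdvd d a -> gdvd d b -> gdvd d (a - b).
Proof. by move=> da db; apply/gdvdD => //; apply: gdvdN. Qed.
Lemma gdvdMr d a b : b \in ZI -> gdvd d a -> gdvd d (a * b).
Proof. by move=> bZ [h hZ ->]; exists (h * b); rewrite ?rpredM ?mulrA. Qed.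
Lemma gdvdMl d a b : b \in ZI -> gdvd d a -> gdvd d (b * a).
Proof. by rewrite mulrC; apply: gdvdMr. Qed.
Lemma gdvd_mull d a b : d != 0 -> gdvd (d * a) (d * b) <-> gdvd a b.
Proof.
move=> d0; split=> [] [h hZ]; last by move=> ->; exists h; rewrite ?mulrA.
by rewrite -mulrA => /(mulfI d0); exists h.
Qed.
Lemma gdvd_exp d m n g : d \in ZI -> (m <= n)%N -> gdvd (d ^+ n) g -> gdvd (d ^+ m) g.
Proof.
move=> dZ mn [h hZ ->]; exists (d ^+ (n - m) * h); first by rewrite rpredM ?rpredX.
by rewrite mulrA -exprD subnKC.
Qed.

(** Below, [P'] is a Gaussian integer of prime norm [p] with conjugate [P], not
    dividing [P], and [io] is the residue of [i] in [Z[i]/(P') = Z/p]. Congruences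
    modulo [P' ^+ L] are reduced to congruences of integers modulo [p ^ L]. *)
Section Prime.
Variables (P P' : C) (p io : nat).
Hypotheses (PZ : P \in ZI) (P'Z : P' \in ZI) (PJ : P'^* = P).
Hypotheses (PP : P * P' = p%:R) (p_pr : prime p).
Hypotheses (P'i : gdvd P' ('i%C - io%:R)) (P'NP : ~ gdvd P' P).

Lemma gprime_neq0 : P' != 0.
Proof.
apply/eqP => P0; move: PP; rewrite P0 mulr0 => /esym/eqP.
by rewrite pnatr_eq0 -leqn0 leqNgt prime_gt0.
Qed.

Lemma gprimeX_neq0 L : P' ^+ L != 0. Proof. by rewrite expf_neq0 ?gprime_neq0. Qed.

Lemma gprime_p L : p%:R ^+ L = P' ^+ L * P ^+ L.
Proof. by rewrite -exprMn [P' * _]mulrC PP. Qed.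

Lemma gprime_dvdp L x : (p ^ L %| x)%N -> gdvd (P' ^+ L) x%:R.
Proof.
move=> /dvdnP[k ->]; exists (P ^+ L * k%:R); first by rewrite rpredM ?rpredX ?rpred_nat.
by rewrite mulrA -gprime_p natrM natrX mulrC.
Qed.

Lemma gprime_int (x : int) : exists y : nat, gdvd P' (x%:~R - y%:R).
Proof.
exists (absz (modz x p)).
have p0 : (p%:Z != 0) by rewrite eqz_nat -lt0n prime_gt0.
have -> : ((absz (modz x p))%:R : C) = (modz x p)%:~R.
  by rewrite -[X in _ = X%:~R]gez0_abs ?modz_ge0.
exists (P * (divz x p)%:~R); first by rewrite rpredM ?gaussian_int.
rewrite {1}(divz_eq x p) rmorphD rmorphM /= addrK mulrC mulrA [P' * P]mulrC PP.
by rewrite pmulrn.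
Qed.

Lemma gprime_res1 g : g \in ZI -> exists x : nat, gdvd P' (g - x%:R).
Proof.
move=> /gaussianP[x [y ->]].
have [k kE] := gprime_int (x + io%:Z * y); exists k.
have -> : x%:~R + y%:~R * 'i%C - k%:R =
  ((x + io%:Z * y)%:~R - k%:R) + ('i%C - io%:R) * y%:~R :> C.
  by rewrite rmorphD rmorphM /= -pmulrn; ring.
by apply: gdvdD => //; apply/gdvdMr => //; apply: gaussian_int.
Qed.

Lemma gprime_dvdn x : gdvd P' x%:R -> (p %| x)%N.
Proof.
move=> [h hZ xE]; have [n nE] := gaussian_norm hZ.
suff e : (x ^ 2 = p * n)%N.
  by have := Euclid_dvdX x 2 p_pr; rewrite andbT => <-; rewrite e dvdn_mulr.
apply/eqP; rewrite -(eqr_nat C) natrX natrM -nE -PP -PJ.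
have -> : (x%:R : C) ^+ 2 = x%:R * (x%:R)^* by rewrite conjC_nat.
by rewrite xE rmorphM /=; apply/eqP; ring.
Qed.

(** [P'] is a prime element of [Z[i]]. *)
Lemma gprimeM g h : g \in ZI -> h \in ZI ->
  gdvd P' (g * h) -> gdvd P' g \/ gdvd P' h.
Proof.
move=> gZ hZ ghP; have [x gx] := gprime_res1 gZ; have [y hy] := gprime_res1 hZ.
have : (p %| x * y)%N.
  apply: gprime_dvdn; rewrite natrM.
  have -> : x%:R * y%:R = g * h - (g - x%:R) * h - (h - y%:R) * x%:R :> C by ring.
  by do !apply: gdvdB => //; apply: gdvdMr; rewrite ?rpred_nat.
rewrite Euclid_dvdM // -[p]expn1 => /orP[] /gprime_dvdp; rewrite expr1 => d.
  by left; rewrite -(subrK x%:R g); apply: gdvdD.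
by right; rewrite -(subrK y%:R h); apply: gdvdD.
Qed.

Lemma gprimeX g n : g \in ZI -> gdvd P' (g ^+ n) -> gdvd P' g.
Proof.
move=> gZ; elim: n => [|n IH]; rewrite ?expr0 ?exprS.
  by move=> /(@gprime_dvdn 1); rewrite Euclid_dvd1.
by move=> /gprimeM[||//|//]; rewrite ?rpredX.
Qed.

Lemma gprime_cancel L g h : g \in ZI -> h \in ZI -> ~ gdvd P' g ->
  gdvd (P' ^+ L) (g * h) -> gdvd (P' ^+ L) h.
Proof.
move=> gZ hZ gP; elim: L h hZ => [|L IH] h hZ; first by exists h; rewrite // expr0 mul1r.
move=> ghP; have : gdvd P' (g * h) by rewrite -[P']expr1; apply: gdvd_exp ghP.
move=> /gprimeM[//|//|//|[k kZ hE]]; move: ghP; rewrite hE mulrCA exprS.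
by move=> /(gdvd_mull _ _ gprime_neq0)/(IH _ kZ)/(gdvd_mull _ _ gprime_neq0).
Qed.

Lemma gprime_natX L x : gdvd (P' ^+ L) x%:R -> (p ^ L %| x)%N.
Proof.
elim: L x => [|L IH] x xP; first by rewrite expn0 dvd1n.
have : gdvd P' x%:R by rewrite -[P']expr1; apply: gdvd_exp xP.
move=> /gprime_dvdn/dvdnP[k xE]; move: xP; rewrite xE natrM -PP mulrA mulrC exprS.
move=> /(gdvd_mull _ _ gprime_neq0); rewrite mulrC.
move=> /(gprime_cancel PZ (rpred_nat _ _) P'NP)/IH kL.
by rewrite expnSr dvdn_mul.
Qed.

(** The integers congruent modulo [P' ^+ L] are those congruent modulo [p ^ L]. *)
Lemma gprime_eqmod L x y : gdvd (P' ^+ L) (x%:R - y%:R) <-> (x = y %[mod p ^ L])%N.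
Proof.
wlog yx : x y / (y <= x)%N.
  move=> H; have /orP[/H//|/H {}H] := leq_total y x; split.
    by move=> d; apply/esym/H; rewrite -opprB; apply: gdvdN.
  by move=> d; rewrite -opprB; apply/gdvdN/H/esym.
rewrite -natrB //; split=> [/gprime_natX|].
  by rewrite -eqn_mod_dvd // => /eqP.
by move/eqP; rewrite eqn_mod_dvd // => /gprime_dvdp.
Qed.

Lemma gprime_inv L x : ~~ (p %| x)%N -> exists u, (u * x = 1 %[mod p ^ L])%N.
Proof.
move=> px; have x0 : (0 < x)%N by case: x px => //; rewrite dvdn0.
have cop : coprime x (p ^ L)%N by rewrite coprimeXr // coprime_sym prime_coprime.
have [u v uE _] := egcdnP (p ^ L)%N x0; exists u.
by rewrite uE (eqP cop) modnMDl.
Qed.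

(** Every Gaussian integer is congruent to a natural number modulo [P' ^+ L]. *)
Lemma gprime_res L g : g \in ZI -> exists x : nat, gdvd (P' ^+ L) (g - x%:R).
Proof.
move=> gZ; elim: L => [|L [x [h hZ hE]]].
  by exists 0%N, g => //; rewrite expr0 mul1r subr0.
(* [x] is corrected by a multiple of [p ^ L = P' ^+ L * P ^+ L], where [P ^+ L] is
   invertible modulo [P']. *)
have [z hz] := gprime_res1 hZ.
have [w wP] := gprime_res1 (rpredX L PZ).
have pw : ~~ (p %| w)%N.
  apply/negP => /dvdnP[k wE]; apply/P'NP/(gprimeX PZ (n := L)).
  rewrite -(subrK w%:R (P ^+ L)); apply: gdvdD => //.
  by rewrite -[P']expr1; apply: gprime_dvdp; rewrite wE expn1 dvdn_mull.
have [u uE] := gprime_inv 1 pw.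
exists (x + p ^ L * (u * z))%N.
have -> : g - (x + p ^ L * (u * z))%N%:R = P' ^+ L * (h - P ^+ L * (u * z)%N%:R).
  rewrite natrD natrM natrX gprime_p opprD addrA hE; ring.
rewrite exprSr; apply/gdvd_mull; first exact: gprimeX_neq0.
have -> : h - P ^+ L * (u * z)%N%:R =
  (h - z%:R) - (P ^+ L - w%:R) * (u * z)%N%:R - ((u * w * z)%N%:R - z%:R).
  by rewrite !natrM; ring.
apply: gdvdB; first by apply: gdvdB => //; apply: gdvdMr; rewrite ?rpred_nat.
rewrite -[P']expr1; apply/gprime_eqmod.
by rewrite -modnMml uE modnMml mul1n.
Qed.

Lemma gprime_solve L w g : w \in ZI -> ~ gdvd P' w -> g \in ZI ->
  exists y : nat, gdvd (P' ^+ L) (y%:R * w - g).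
Proof.
move=> wZ wP gZ; have [x wx] := gprime_res L wZ; have [z gz] := gprime_res L gZ.
case: L wx gz => [|L] wx gz.
  by exists 0%N, (0%N%:R * w - g); rewrite ?rpredB ?rpredM ?rpred_nat // expr0 mul1r.
have px : ~~ (p %| x)%N.
  apply/negP; rewrite -[p]expn1 => /gprime_dvdp xP; apply: wP.
  rewrite -(subrK x%:R w); apply: gdvdD; rewrite -[P']expr1 //.
  exact: gdvd_exp wx.
have [u uE] := gprime_inv L.+1 px; exists (u * z)%N.
have -> : (u * z)%N%:R * w - g =
  (w - x%:R) * (u * z)%N%:R - (g - z%:R) + ((u * x * z)%N%:R - z%:R).
  by rewrite !natrM; ring.
apply: gdvdD; first by apply: gdvdB => //; apply: gdvdMr; rewrite ?rpred_nat.
by apply/gprime_eqmod; rewrite -modnMml uE modnMml mul1n.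
Qed.

(** A nonzero Gaussian integer has a finite [P']-adic valuation. *)
Lemma gprime_val g : g \in ZI -> g != 0 -> exists E, ~ gdvd (P' ^+ E) g.
Proof.
move=> gZ g0; have [n nE] := gaussian_norm gZ; exists n => -[h hZ hE].
have [m mE] := gaussian_norm hZ.
have n_gt0 : (0 < n)%N.
  rewrite lt0n -(eqr_nat C) -nE mulf_neq0 // ?conjC_eq0 //.
have : (n = p ^ n * m)%N.
  apply/eqP; rewrite -(eqr_nat C) natrM natrX -mE -PP -PJ -nE {1 2}hE.
  by rewrite !(rmorphM, rmorphXn) /= exprMn; apply/eqP; ring.
move: n_gt0; case: m {mE} => [|m] n_gt0 e; first by rewrite e muln0 in n_gt0.
have := ltn_expl n (prime_gt1 p_pr); rewrite ltnNge => /negP; apply.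
by rewrite {2}e leq_pmulr.
Qed.

End Prime.
End GaussianDivisibility.

(** * The modulus of a complex number *)

(** [cnorm] is the real-valued modulus, whereas [`|z|] lives in [R[i]]. *)
Section ComplexNorm.
Local Open Scope complex_scope.
Local Open Scope ring_scope.
Variable R : realType.
Local Notation C := R[i].
Local Notation "'ZI'" := (@gaussian R).
Local Notation cnorm := (@Normc.normc R).
Implicit Types z w : C.

Lemma cnormM z w : cnorm (z * w) = cnorm z * cnorm w.
Proof. exact: Normc.normcM. Qed.
Lemma cnormV z : cnorm z^-1 = (cnorm z)^-1.
Proof. exact: Normc.normcV. Qed.
Lemma cnormD z w : cnorm (z + w) <= cnorm z + cnorm w.
Proof. exact: le_normcD. Qed.
Lemma cnormN z : cnorm (- z) = cnorm z.
Proof. exact: normcN. Qed.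
Lemma cnorm_ge0 z : 0 <= cnorm z.
Proof. by case: z => a b; apply: sqrtr_ge0. Qed.
Lemma cnorm0 : cnorm 0 = 0. Proof. exact: Normc.normc0. Qed.
Lemma cnorm1 : cnorm 1 = 1. Proof. exact: Normc.normc1. Qed.
Lemma cnormX z n : cnorm (z ^+ n) = cnorm z ^+ n.
Proof. by elim: n => [|n IH]; rewrite ?cnorm1 // !exprS cnormM IH. Qed.
Lemma cnorm_gt0 z : z != 0 -> 0 < cnorm z.
Proof.
move=> z0; rewrite lt_def cnorm_ge0 andbT; apply: contra_neq z0.
exact: Normc.eq0_normc.
Qed.
Lemma cnorm_Re z : `|complex.Re z| <= cnorm z.
Proof.
by case: z => a b /=; rewrite -sqrtr_sqr ler_wsqrtr // lerDl sqr_ge0.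
Qed.
Lemma cnorm_real (x : R) : cnorm x%:C = `|x|.
Proof. by rewrite /= expr0n addr0 sqrtr_sqr. Qed.
Lemma cnorm_nat n : cnorm n%:R = n%:R.
Proof. by rewrite -(rmorph_nat (@real_complex_def R (Phant R))) cnorm_real normr_nat. Qed.
Lemma cnorm_i : cnorm 'i%C = 1.
Proof. by rewrite /= expr0n add0r expr1n sqrtr1. Qed.
Lemma cnorm_ReIm (a b : R) : cnorm (a +i* b) <= `|a| + `|b|.
Proof.
have -> : a +i* b = a%:C + b%:C * 'i%C by simpc.
by rewrite (le_trans (cnormD _ _)) // cnormM cnorm_i mulr1 !cnorm_real.
Qed.
Lemma cnormE z : `|z| = (cnorm z)%:C.
Proof. by case: z. Qed.
Lemma cnorm_conj z : cnorm z^* = cnorm z.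
Proof. by case: z => a b /=; rewrite sqrrN. Qed.

Lemma gaussian_round z : exists2 g, g \in ZI & cnorm (z - g) <= 1.
Proof.
have rd (x : R) : exists k : int, `|x - k%:~R| <= 2^-1.
  exists (Num.floor (x + 2^-1)).
  have /andP[] := floor_itv (x + 2^-1).
  rewrite rmorphD /= => h1 h2; rewrite ler_norml; apply/andP; split; lra.
case: z => a b; have [k hk] := rd a; have [l hl] := rd b.
exists (k%:~R +i* l%:~R); first by rewrite unfold_in /= !intr_int.
apply: le_trans (cnorm_ReIm _ _) _; lra.
Qed.
End ComplexNorm.

(** * Density of orbits near a prime *)

(** [P'] is as in the previous section on divisibility, and [Q / Q'] is a quotient of
    [P']-adic units that is not a root of unity. *)
Section PrimeDensity.
Local Open Scope complex_scope.
Local Open Scope ring_scope.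
Variable R : realType.
Local Notation C := R[i].
Local Notation "'ZI'" := (@gaussian R).
Local Notation cnorm := (@Normc.normc R).
Variables (P P' Q Q' : C) (p io : nat).
Hypotheses (PZ : P \in ZI) (P'Z : P' \in ZI) (PJ : P'^* = P).
Hypotheses (PP : P * P' = p%:R) (p_pr : prime p) (p_odd : odd p).
Hypotheses (P'i : gdvd P' ('i%C - io%:R)) (P'NP : ~ gdvd P' P).
Hypotheses (QZ : Q \in ZI) (Q'Z : Q' \in ZI).
Hypotheses (P'NQ : ~ gdvd P' Q) (P'NQ' : ~ gdvd P' Q').
Hypothesis QX_neq : forall M, (0 < M)%N -> Q ^+ M != Q' ^+ M.

Lemma gprime_split n h : h \in ZI -> ~ gdvd (P' ^+ n) h ->
  exists k w, [/\ w \in ZI, h = P' ^+ k * w & ~ gdvd P' w].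
Proof.
elim: n h => [|n IH] h hZ hP; first by case: hP; exists h; rewrite // expr0 mul1r.
have [[h' h'Z hE]|hP'] := pselect (gdvd P' h); last first.
  by exists 0%N, h; split; rewrite // expr0 mul1r.
have [||k [w [wZ h'E wP]]] := IH h' => //.
  by move=> h'P; apply: hP; rewrite hE exprS; apply/gdvd_mull => //; apply: gprime_neq0 PP p_pr.
by exists k.+1, w; split; rewrite // hE h'E exprS mulrA.
Qed.

Lemma gprime_fermat g : g \in ZI -> ~ gdvd P' g -> gdvd P' (g ^+ p.-1 - 1).
Proof.
move=> gZ gP; have [x gx] := gprime_res1 PZ PP p_pr P'i gZ.
have px : coprime x p.
  rewrite coprime_sym prime_coprime //; apply/negP; rewrite -[p]expn1.
  move=> /(gprime_dvdp PZ PP); rewrite expr1 => xP; apply: gP.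
  by rewrite -(subrK x%:R g); apply: gdvdD.
have gxX n : gdvd P' (g ^+ n - x%:R ^+ n).
  rewrite subrXX; apply: gdvdMr => //; apply: rpred_sum => i _.
  by rewrite rpredM ?rpredX ?rpred_nat.
rewrite -(subrK (x%:R ^+ p.-1) (g ^+ p.-1)) -addrA; apply: gdvdD => //.
rewrite -[P']expr1 -natrX; apply/(gprime_eqmod PZ P'Z PJ PP p_pr P'i P'NP 1 _ 1).
by rewrite expn1 -totient_prime //; apply: Euler_exp_totient.
Qed.

Lemma cnorm_prime2 : cnorm P' ^+ 2 = p%:R.
Proof. by rewrite -cnorm_nat -PP cnormM -PJ cnorm_conj expr2. Qed.

Lemma cnorm_prime_ge1 : 1 <= cnorm P'.
Proof.
by rewrite -(@ler_pXn2r _ 2) ?nnegrE ?cnorm_ge0 // expr1n cnorm_prime2 ler1n prime_gt0.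
Qed.

Lemma cnorm_prime_large (B : R) : exists L0, forall L, (L0 <= L)%N -> B < cnorm P' ^+ L.
Proof.
exists (2 * Num.bound `|B|)%N => L /(ler_weXn2l cnorm_prime_ge1); apply: lt_le_trans.
rewrite exprM cnorm_prime2 -natrX.
apply: le_lt_trans (ler_norm _) _; apply: lt_le_trans (archi_boundP (normr_ge0 B)) _.
by rewrite ler_nat ltnW // ltn_expl // prime_gt1.
Qed.

Lemma multiple_above K L0 N : (0 < N)%N ->
  exists r L', [/\ (N * r = K + L')%N, (L0 < L')%N & (L' <= L0 + N)%N].
Proof.
move=> N_gt0; have := divn_eq (K + L0) N; have := ltn_pmod (K + L0) N_gt0.
move: (_ %% _)%N (_ %/ _)%N => b q bN e.
exists q.+1, (N * q.+1 - K)%N; rewrite mulnS; split; lia.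
Qed.

(** Expansion at [P'] makes orbits dense. Here [P / P'] divides by [P'], up to a
    [P']-adic unit, and [Q / Q'] is a [P']-adic unit. If [kappa] has [P']-adic
    valuation [v < n], large, a power of [P / P'] brings its valuation down to a
    prescribed range of values [- L']. The result is then multiplied by powers of
    [(Q / Q') ^+ M], that is, modulo high powers of [P'], by powers of an integer
    [hh = 1 mod p]. By [powers_cover] these fill a class [1 + p ^ E Z] with [E]
    independent of [L'], so that the orbit meets all cells of a lattice of mesh
    proportional to [p ^ E / |P'| ^ L'], which is small when [L'] is large. *)
Lemma prime_orbit_dense N c (tau : C) (eps : R) : (0 < N)%N -> 0 < eps ->
  exists m C0, forall n kappa, gdvd ((P' * Q') ^+ m) kappa -> ~ gdvd (P' ^+ n) kappa ->
  exists r s g, [/\ (r <= n + C0)%N, (s <= n + C0)%N, g \in ZI &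
    cnorm (kappa * (P / P') ^+ (N * r) * (Q / Q') ^+ (N * s) + (P' * Q') ^+ c * g - tau)
      < eps].
Proof.
move=> N_gt0 eps_gt0.
have P'0 : P' != 0 := gprime_neq0 PP p_pr.
have Q'0 : Q' != 0 by apply/eqP => Q'0; apply: P'NQ'; rewrite Q'0; apply: gdvd0.
have p1_gt0 : (0 < p.-1)%N by rewrite -subn1 subn_gt0 prime_gt1.
(* The factor [p.-1] makes [(Q / Q') ^+ M] congruent to [1] modulo [P']. *)
pose M := (N * p.-1)%N; have M_gt0 : (0 < M)%N by rewrite muln_gt0 N_gt0.
have QMZ n : Q ^+ n \in ZI by apply: rpredX.
have Q'MZ n : Q' ^+ n \in ZI by apply: rpredX.
have [E hE] : exists E, ~ gdvd (P' ^+ E) (Q ^+ M - Q' ^+ M).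
  by apply: (gprime_val PJ PP p_pr); rewrite ?rpredB ?subr_eq0 ?QX_neq.
pose B := cnorm (P' * Q') ^+ c * p%:R ^+ E / eps.
have [L1 hL1] := cnorm_prime_large B.
pose L0 := (L1 + E)%N; pose S := (p ^ (L0 + N + c))%N.
exists (M * S + c)%N, (p.-1 * S + L0 + N)%N => n kappa [h hZ kappaE] kappaP.
have [k [w [wZ hw wP]]] : exists k w, [/\ w \in ZI, h = P' ^+ k * w & ~ gdvd P' w].
  apply: (gprime_split (n := n)) => // -[h' h'Z h'E]; apply: kappaP.
  exists ((P' * Q') ^+ (M * S + c) * h'); first by rewrite rpredM ?rpredX ?rpredM.
  by rewrite kappaE h'E mulrCA.
pose m := (M * S + c)%N.
have {}kappaE : kappa = P' ^+ (m + k) * Q' ^+ m * w.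
  by rewrite kappaE hw -/m exprMn exprD; ring.
have kn : (m + k < n)%N.
  rewrite ltnNge; apply/negP => nk; apply: kappaP.
  exists (P' ^+ (m + k - n) * Q' ^+ m * w); first by rewrite !rpredM ?rpredX.
  by rewrite !mulrA -exprD subnKC.
have [r [L' [NrE L'lo L'hi]]] := multiple_above (m + k) L0 N_gt0.
pose L := (L' + c)%N.
have L0L : (L0 < L)%N by rewrite ltn_addr.
have EL : (E <= L)%N by apply: leq_trans (ltnW L0L); apply: leq_addl.
(* Modulo [P' ^+ L], the unit [(Q / Q') ^+ M] is the integer [hh]. *)
have [hh hhE] : exists hh : nat, gdvd (P' ^+ L) (hh%:R * Q' ^+ M - Q ^+ M).
  apply: (gprime_solve PZ P'Z PJ PP p_pr P'i P'NP) => //.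
  by move=> /(gprimeX PZ PJ PP p_pr P'i Q'Z).
have dvdQ : gdvd P' (Q ^+ M - Q' ^+ M).
  have one g : g \in ZI -> ~ gdvd P' g -> gdvd P' (g ^+ M - 1).
    move=> gZ gP; rewrite /M mulnC exprM subrX1; apply: gdvdMr.
      by apply: rpred_sum => i _; rewrite !rpredX.
    exact: gprime_fermat.
  have -> : Q ^+ M - Q' ^+ M = (Q ^+ M - 1) - (Q' ^+ M - 1) by ring.
  by apply: gdvdB; apply: one.
have h1 : (hh = 1 %[mod p])%N.
  rewrite -[p]expn1; apply/(gprime_eqmod PZ P'Z PJ PP p_pr P'i P'NP); rewrite expr1.
  have : gdvd P' (Q' ^+ M * (hh%:R - 1%:R)).
    have -> : Q' ^+ M * (hh%:R - 1%:R) = (hh%:R * Q' ^+ M - Q ^+ M) + (Q ^+ M - Q' ^+ M).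
      by ring.
    apply: gdvdD => //; rewrite -[P']expr1; apply: gdvd_exp hhE => //.
    by apply: leq_trans L0L.
  case/(gprimeM PZ PJ PP p_pr P'i) => //; first by rewrite rpredB ?rpred_nat.
  by move=> /(gprimeX PZ PJ PP p_pr P'i Q'Z).
have hNE : (hh <> 1 %[mod p ^ E])%N.
  move=> /(gprime_eqmod PZ P'Z PJ PP p_pr P'i P'NP) hh1; apply: hE.
  have -> : Q ^+ M - Q' ^+ M = (hh%:R - 1%:R) * Q' ^+ M - (hh%:R * Q' ^+ M - Q ^+ M).
    by ring.
  by apply: gdvdB; [apply: gdvdMr | apply: gdvd_exp hhE].
(* Up to the factor [(P' * Q') ^+ c], the point [kappa * (P / P') ^+ (N * r)] is
   [w0 / P' ^+ L], and its translates by [p ^ E * G / P' ^+ L] form a fine grid. *)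
pose w0 := P ^+ (N * r) * w * Q' ^+ (M * S).
have w0Z : w0 \in ZI by rewrite !rpredM ?rpredX.
have w0P : ~ gdvd P' w0.
  move=> /(gprimeM PZ PJ PP p_pr P'i) []; rewrite ?rpredM ?rpredX //.
    move=> /(gprimeM PZ PJ PP p_pr P'i) []; rewrite ?rpredX //.
    by move=> /(gprimeX PZ PJ PP p_pr P'i PZ).
  by move=> /(gprimeX PZ PJ PP p_pr P'i Q'Z).
have [G GZ hG] := gaussian_round
  ((tau / (P' * Q') ^+ c - w0 / P' ^+ L) * P' ^+ L / p%:R ^+ E).
have [y hy] := gprime_solve PZ P'Z PJ PP p_pr P'i P'NP L w0Z w0P GZ.
(* [x * w0] is congruent to [w0 + p ^ E * G] modulo [P' ^+ L]. *)
pose x := (1 + p ^ E * y)%N.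
have xE : (x = 1 %[mod p ^ E])%N by rewrite /x addnC mulnC modnMDl.
have [s' s'L hs'] := powers_cover p_pr p_odd L h1 hNE xE.
have s'S : (s' <= S)%N.
  by apply/(leq_trans (ltnW s'L)); rewrite /S leq_exp2l ?prime_gt1 // leq_add2r.
pose ws := P ^+ (N * r) * w * (Q' ^+ (M * (S - s')) * Q ^+ (M * s')).
have [g' g'Z wsE] : gdvd (P' ^+ L) (ws - (w0 + p%:R ^+ E * G)).
  have -> : ws - (w0 + p%:R ^+ E * G) =
      P ^+ (N * r) * w * Q' ^+ (M * (S - s')) * ((Q ^+ M) ^+ s' - (hh%:R * Q' ^+ M) ^+ s')
      + ((hh ^ s')%:R - x%:R) * w0 + p%:R ^+ E * (y%:R * w0 - G).
    have -> : w0 = P ^+ (N * r) * w * (Q' ^+ (M * (S - s')) * Q' ^+ (M * s')).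
      by rewrite -exprD -mulnDr subnK.
    rewrite exprMn -!exprM /x natrD natrM !natrX /ws.
    move: (P ^+ _) (Q' ^+ _) (Q' ^+ _) (Q ^+ _) (hh%:R ^+ _) (p%:R ^+ _).
    by move=> a1 a2 a3 a4 a5 a6; ring.
  apply: gdvdD; first apply: gdvdD.
  - apply: gdvdMl; rewrite ?rpredM ?rpredX // subrXX; apply: gdvdMr.
      by apply: rpred_sum => i _; rewrite !rpredM ?rpredX ?rpredM ?rpred_nat ?rpredX.
    by rewrite -opprB; apply: gdvdN.
  - by apply: gdvdMr => //; apply/(gprime_eqmod PZ P'Z PJ PP p_pr P'i P'NP).
  - by apply: gdvdMl => //; rewrite rpredX ?rpred_nat.
exists r, (p.-1 * s')%N, (- g'); split.
- apply: leq_trans (_ : N * r <= _)%N; first by rewrite leq_pmull.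
  rewrite NrE leq_add ?(ltnW kn) //; apply: leq_trans L'hi _.
  by rewrite -addnA leq_addl.
- apply: leq_trans (leq_addl _ _); rewrite -addnA.
  by apply: leq_trans (leq_addr _ _); rewrite leq_mul.
- by rewrite rpredN.
have -> : kappa * (P / P') ^+ (N * r) * (Q / Q') ^+ (N * (p.-1 * s')) +
   (P' * Q') ^+ c * - g' - tau =
   (P' * Q') ^+ c * p%:R ^+ E / P' ^+ L *
   (G - (tau / (P' * Q') ^+ c - w0 / P' ^+ L) * P' ^+ L / p%:R ^+ E).
  have -> : (N * (p.-1 * s') = M * s')%N by rewrite mulnA.
  have QmE : Q' ^+ m = Q' ^+ (M * (S - s')) * Q' ^+ (M * s') * Q' ^+ c.
    by rewrite -!exprD -mulnDr subnK.
  have wsE' : ws = P' ^+ L * g' + (w0 + p%:R ^+ E * G) by rewrite -wsE subrK.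
  have PL : P' ^+ L = P' ^+ L' * P' ^+ c by rewrite exprD.
  have p0 : p%:R != 0 :> C by rewrite pnatr_eq0 -lt0n prime_gt0.
  have -> : (P' * Q') ^+ c * p%:R ^+ E / P' ^+ L *
     (G - (tau / (P' * Q') ^+ c - w0 / P' ^+ L) * P' ^+ L / p%:R ^+ E) =
     (P' * Q') ^+ c * (ws / P' ^+ L - g') - tau.
    rewrite wsE' exprMn; field.
    by rewrite !expf_neq0.
  rewrite mulrBr mulrN; congr (_ - _ - _).
  rewrite kappaE QmE /ws !expr_div_n !NrE PL exprMn [P' ^+ (m + k + L')]exprD.
  by field; rewrite !expf_neq0.
rewrite !cnormM -[X in _ * X]cnormN opprB cnormV.
apply: le_lt_trans (ler_wpM2l _ hG) _; first by rewrite !mulr_ge0 ?invr_ge0 ?cnorm_ge0.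
rewrite mulr1 !cnormX cnorm_nat ltr_pdivrMr ?exprn_gt0 ?cnorm_gt0 // [eps * _]mulrC.
rewrite -ltr_pdivrMr //.
by apply: hL1; apply: leq_trans (ltnW L0L); apply: leq_addr.
Qed.
End PrimeDensity.

(** * The primes above 5 and 13 *)

Section Concrete.
Local Open Scope complex_scope.
Local Open Scope ring_scope.
Variable R : realType.
Local Notation C := R[i].
Local Notation "'ZI'" := (@gaussian R).
Local Notation cnorm := (@Normc.normc R).
Local Notation P5 := (P5 R).
Local Notation P13 := (P13 R).

Lemma P5PP : P5 * P5^* = 5%:R.
Proof.
rewrite -(rmorph_nat (@real_complex_def R (Phant R))).
by apply/eqP; rewrite eq_complex /=; apply/andP; split; apply/eqP; ring.
Qed.
Lemma P13PP : P13 * P13^* = 13%:R.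
Proof.
rewrite -(rmorph_nat (@real_complex_def R (Phant R))).
by apply/eqP; rewrite eq_complex /=; apply/andP; split; apply/eqP; ring.
Qed.

Lemma P5'i : gdvd P5^* ('i%C - 3%:R).
Proof.
exists (- 1 - 'i%C); first by rewrite rpredB ?rpredN ?rpred1 ?gaussian_i.
rewrite -(rmorph_nat (@real_complex_def R (Phant R))).
by apply/eqP; rewrite eq_complex /=; apply/andP; split; apply/eqP; ring.
Qed.
Lemma P13'i : gdvd P13^* ('i%C - 5%:R).
Proof.
exists (- 1 - 'i%C); first by rewrite rpredB ?rpredN ?rpred1 ?gaussian_i.
rewrite -(rmorph_nat (@real_complex_def R (Phant R))).
by apply/eqP; rewrite eq_complex /=; apply/andP; split; apply/eqP; ring.
Qed.

(** Multiplying [g = P' * h] by [P] shows that [p] divides [Re (P * g)], which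
    rules out divisibility in the concrete cases below. *)
Lemma gdvd_Re (P P' g : C) (p : nat) (k : int) : P * P' = p%:R ->
  complex.Re (P * g) = k%:~R -> gdvd P' g -> (p %| k)%Z.
Proof.
move=> PP kE [[x y]] /andP[/= /intrP[a ->] _] gE; move: kE.
rewrite gE mulrA PP -(rmorph_nat (@real_complex_def R (Phant R))) /= mul0r subr0.
rewrite pmulrn -intrM => /intr_inj <-; exact: dvdz_mulr.
Qed.

Lemma P5_ndvd_P5 : ~ gdvd P5^* P5.
Proof.
move=> d; suff : (5 %| -3)%Z by [].
by apply: (gdvd_Re P5PP _ d) => /=; ring.
Qed.
Lemma P5_ndvd_P13 : ~ gdvd P5^* P13.
Proof.
move=> d; suff : (5 %| -4)%Z by [].
by apply: (gdvd_Re P5PP _ d) => /=; ring.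
Qed.
Lemma P5_ndvd_P13J : ~ gdvd P5^* P13^*.
Proof.
move=> d; suff : (5 %| 8)%Z by [].
by apply: (gdvd_Re P5PP _ d) => /=; ring.
Qed.
Lemma P13_ndvd_P13 : ~ gdvd P13^* P13.
Proof.
move=> d; suff : (13 %| -5)%Z by [].
by apply: (gdvd_Re P13PP _ d) => /=; ring.
Qed.
Lemma P13_ndvd_P5 : ~ gdvd P13^* P5.
Proof.
move=> d; suff : (13 %| -4)%Z by [].
by apply: (gdvd_Re P13PP _ d) => /=; ring.
Qed.
Lemma P13_ndvd_P5J : ~ gdvd P13^* P5^*.
Proof.
move=> d; suff : (13 %| 8)%Z by [].
by apply: (gdvd_Re P13PP _ d) => /=; ring.
Qed.

Lemma P5X_neq M : (0 < M)%N -> P5 ^+ M != P5^* ^+ M.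
Proof.
case: M => // M _; apply/eqP => e; apply: P5_ndvd_P5.
apply: (gprimeX (P5_gaussian R) (conjCK _) P5PP isT P5'i (P5_gaussian R) (n := M.+1)).
by rewrite e exprS; exists (P5^* ^+ M); rewrite ?rpredX ?P5_conj_gaussian.
Qed.
Lemma P13X_neq M : (0 < M)%N -> P13 ^+ M != P13^* ^+ M.
Proof.
case: M => // M _; apply/eqP => e; apply: P13_ndvd_P13.
apply: (gprimeX (P13_gaussian R) (conjCK _) P13PP isT P13'i (P13_gaussian R) (n := M.+1)).
by rewrite e exprS; exists (P13^* ^+ M); rewrite ?rpredX ?P13_conj_gaussian.
Qed.

(** The product of the two inverted primes: [A] is [Z[i]] with [D] inverted. *)
Definition Dbar : C := P5^* * P13^*.
Local Notation D := Dbar.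

Lemma D_gaussian : D \in ZI.
Proof. by rewrite rpredM ?P5_conj_gaussian ?P13_conj_gaussian. Qed.
Lemma D_neq0 : D != 0.
Proof. by rewrite mulf_neq0 ?P5_conj_neq0 ?P13_conj_neq0. Qed.

Lemma DbarE : D = P5^* * P13^*. Proof. by []. Qed.

(** The two cases of [prime_orbit_dense] combined: a Gaussian integer [kappa] that is
    highly divisible by [D], but not by [D ^+ n], has a multiple by [theta5 ^+ (N * r)]
    and [theta13 ^+ (N * s)] close to [tau] modulo [D ^+ c * Z[i]], and the exponents
    are bounded in terms of [n]. *)
Lemma orbit_dense N c (tau : C) (eps : R) : (0 < N)%N -> 0 < eps ->
  exists m C0, forall n kappa, gdvd (D ^+ m) kappa -> ~ gdvd (D ^+ n) kappa ->
  exists r s g, [/\ (r <= n + C0)%N, (s <= n + C0)%N, g \in ZI &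
    cnorm (kappa * (P5 / P5^*) ^+ (N * r) * (P13 / P13^*) ^+ (N * s)
           + D ^+ c * g - tau) < eps].
Proof.
move=> N0 e0.
have [m1 [C1 H1]] := prime_orbit_dense (P5_gaussian R) (P5_conj_gaussian R)
  (conjCK _) P5PP isT isT P5'i P5_ndvd_P5 (P13_gaussian R) (P13_conj_gaussian R)
  P5_ndvd_P13 P5_ndvd_P13J P13X_neq c tau N0 e0.
have [m2 [C2 H2]] := prime_orbit_dense (P13_gaussian R) (P13_conj_gaussian R)
  (conjCK _) P13PP isT isT P13'i P13_ndvd_P13 (P5_gaussian R) (P5_conj_gaussian R)
  P13_ndvd_P5 P13_ndvd_P5J P5X_neq c tau N0 e0.
have DC : P13^* * P5^* = D by exact: mulrC.
rewrite {}DC in H2; rewrite -DbarE in H1.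
exists (m1 + m2)%N, (C1 + C2)%N => n kappa km kn.
have kZ : kappa \in ZI by case: km => h hZ ->; rewrite rpredM ?rpredX ?D_gaussian.
have [k5|k5] := pselect (gdvd (P5^* ^+ n) kappa).
  have k13 : ~ gdvd (P13^* ^+ n) kappa.
    case: k5 => h hZ kE; rewrite kE.
    move=> /(gprime_cancel (P13_gaussian R) (P13_conj_gaussian R) (conjCK _) P13PP isT P13'i).
    case; rewrite ?rpredX ?P5_conj_gaussian //.
      move=> /(gprimeX (P13_gaussian R) (conjCK _) P13PP isT P13'i (P5_conj_gaussian R)).
      exact: P13_ndvd_P5J.
    move=> h' h'Z hE; apply: kn; exists h'; first exact: h'Z.
    by rewrite DbarE kE hE mulrA -exprMn.
  case: (H2 n kappa _ k13) => [|r [s [g [rn sn gZ H]]]].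
    by apply: gdvd_exp km; rewrite ?D_gaussian ?leq_addl.
  exists s, r, g; split.
  - by apply: leq_trans sn _; rewrite leq_add2l leq_addl.
  - by apply: leq_trans rn _; rewrite leq_add2l leq_addl.
  - exact: gZ.
  - by rewrite -(mulrAC kappa).
case: (H1 n kappa _ k5) => [|r [s [g [rn sn gZ H]]]].
  by apply: gdvd_exp km; rewrite ?D_gaussian ?leq_addr.
exists r, s, g; split.
- by apply: leq_trans rn _; rewrite leq_add2l leq_addr.
- by apply: leq_trans sn _; rewrite leq_add2l leq_addr.
- exact: gZ.
- exact: H.
Qed.
End Concrete.

(** * Irrational rotations of the plane *)

Lemma pigeonhole_fin (T : finType) (F : nat -> T) :
  exists j j', (j < j')%N /\ F j = F j'.
Proof.
have /injectivePn[i [i' ii' Fii']] : ~~ injectiveb (fun i : 'I_#|T|.+1 => F i).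
  by apply/negP => /injectiveP/leq_card; rewrite card_ord ltnn.
have [lt|gt|eq] := ltngtP i i'.
- by exists i, i'.
- by exists i', i.
- by case/eqP: ii'; apply: val_inj.
Qed.

Section Rotation.
Local Open Scope complex_scope.
Local Open Scope ring_scope.
Variable R : realType.
Local Notation C := R[i].
Local Notation cnorm := (@Normc.normc R).

(** Dirichlet's box principle in the unit square. *)
Lemma pigeonhole_square (f g : nat -> R) (e : R) : 0 < e ->
  (forall j, 0 <= f j < 1) -> (forall j, 0 <= g j < 1) ->
  exists j j', [/\ (j < j')%N, `|f j' - f j| < e & `|g j' - g j| < e].
Proof.
move=> e0 f01 g01.
pose n := (Num.bound e^-1).+1.
have nE : n%:R^-1 < e.
  rewrite invf_plt ?posrE ?ltr0n //; apply: lt_trans (archi_boundP _) _.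
    by rewrite invr_ge0 ltW.
  by rewrite ltr_nat.
have n0 : 0 < n%:R :> R by rewrite ltr0n.
have box (h : nat -> R) : (forall j, 0 <= h j < 1) -> forall j,
    (Num.truncn (n%:R * h j) < n)%N /\
    (Num.truncn (n%:R * h j))%:R <= n%:R * h j < (Num.truncn (n%:R * h j)).+1%:R.
  move=> h01 j; have /andP[h0 h1] := h01 j.
  have nh0 : 0 <= n%:R * h j by rewrite mulr_ge0 // ltW.
  have ht := Num.Theory.truncn_itv nh0; split=> //.
  rewrite -(ltr_nat R); case/andP: ht => ht _; apply: le_lt_trans ht _.
  by rewrite -[ltRHS]mulr1 ltr_pM2l.
have close (h : nat -> R) j j' : (forall j, 0 <= h j < 1) ->
    Num.truncn (n%:R * h j) = Num.truncn (n%:R * h j') -> `|h j' - h j| < e.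
  move=> h01 hjj'; apply: lt_trans nE.
  have [_ /andP[a1 a2]] := box h h01 j; have [_ /andP[b1 b2]] := box h h01 j'.
  rewrite hjj' in a1 a2; rewrite -natr1 in a2; rewrite -natr1 in b2.
  rewrite -[X in _ < X]mulr1 mulrC ltr_pdivlMr // -(gtr0_norm n0) -normrM ltr_norml.
  rewrite mulrC mulrBr; apply/andP; split; lra.
have [j [j' [jj' [Ff Fg]]]] := pigeonhole_fin
  (fun j => (Ordinal (box f f01 j).1, Ordinal (box g g01 j).1)).
by exists j, j'; split=> //; apply: close.
Qed.

(** The point of argument [t] on the unit circle. *)
Definition cis (t : R) : C := cos t +i* sin t.

Lemma cisD a b : cis (a + b) = cis a * cis b.
Proof.
by apply/eqP; rewrite eq_complex /= cosD sinD eqxx /= addrC.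
Qed.

Lemma cis0 : cis 0 = 1.
Proof. by rewrite /cis cos0 sin0. Qed.

Lemma cisMn a n : cis (a *+ n) = cis a ^+ n.
Proof. by elim: n => [|n IH]; rewrite ?mulr0n ?cis0 // mulrS cisD IH exprS. Qed.

Lemma cis_2pi_int (k : int) : cis (2 * pi * k%:~R) = 1.
Proof.
have cis2pi n : cis (2 * pi * n%:R) = 1.
  rewrite mulr_natr cisMn.
  have -> : cis (2 * pi) = 1; last by rewrite expr1n.
  by rewrite /cis mulr_natl cos2pi sin2pi.
case: k => n; first exact: cis2pi.
rewrite NegzE mulrNz mulrN; have := cisD (2 * pi * n.+1%:R) (- (2 * pi * n.+1%:R)).
by rewrite subrr cis0 cis2pi mul1r => <-.
Qed.

Lemma polar1 (w : C) : cnorm w = 1 -> exists t, w = cis t.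
Proof.
case: w => a b /= ab1.
have {}ab1 : a ^+ 2 + b ^+ 2 = 1.
  by rewrite -[LHS]sqr_sqrtr ?ab1 ?expr1n // addr_ge0 ?sqr_ge0.
have a1 : -1 <= a <= 1.
  rewrite -ler_norml -(@expr_le1 _ 2) // -normrX ger0_norm ?sqr_ge0 // -ab1.
  by rewrite lerDl sqr_ge0.
have sE : sin (acos a) = `|b|.
  by rewrite sin_acos // -sqrtr_sqr -ab1 [a ^+ 2 + _]addrC addrK.
have [b0|b0] := leP 0 b.
  by exists (acos a); rewrite /cis sE acosK ?in_itv //= ger0_norm.
exists (- acos a); rewrite /cis cosN sinN sE acosK ?in_itv //= ltr0_norm //.
by rewrite opprK.
Qed.

Lemma polar (z : C) : exists t, z = (cnorm z)%:C * cis t.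
Proof.
have [->|z0] := eqVneq z 0; first by exists 0; rewrite cnorm0 mul0r.
have r0 := cnorm_gt0 z0.
have [|t tE] := @polar1 (z / (cnorm z)%:C).
  by rewrite cnormM cnormV cnorm_real gtr0_norm // divff // gt_eqF.
by exists t; rewrite -tE mulrC divfK // (inj_eq (@complexI R)) gt_eqF.
Qed.

(** The multiples of an irrational number [x] are dense modulo [1]. *)
Lemma multiples_mod1_dense (x y e : R) : 0 < e ->
  (forall d (k : int), (0 < d)%N -> d%:R * x != k%:~R) ->
  exists l (k : int), `|l%:R * x - y - k%:~R| < e.
Proof.
move=> e0 irr.
pose fr j := j%:R * x - (Num.floor (j%:R * x))%:~R.
have fr01 j : 0 <= fr j < 1.
  by have := floor_itv (j%:R * x); rewrite rmorphD /= /fr => /andP[]; lra.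
have [j [j' [jj' h _]]] := pigeonhole_square e0 fr01 fr01.
pose k := Num.floor (j'%:R * x) - Num.floor (j%:R * x).
pose d := (j' - j)%N; pose delta := d%:R * x - k%:~R.
have deltaE : fr j' - fr j = delta.
  by rewrite /delta /fr /d /k natrB ?(ltnW jj') // rmorphB /=; ring.
have delta0 : delta != 0 by rewrite subr_eq0 irr // subn_gt0.
rewrite deltaE in h.
(* A translate of [y] by an integer has the sign of [delta], hence lies within
   [delta] of a natural multiple of [delta]. *)
have [K hK] : exists K : int, 0 <= (y + K%:~R) / delta.
  have yb := archi_boundP (normr_ge0 y); have := ler_norm y; have := ler_norm (- y).
  rewrite normrN => y1 y2.
  have [dp|dn] := ltP 0 delta.
    exists (Num.bound `|y|)%:Z; rewrite divr_ge0 ?(ltW dp) //= -pmulrn.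
    lra.
  exists (- (Num.bound `|y|)%:Z); rewrite -[_ / _]mulrNN -[- delta^-1]invrN.
  apply: mulr_ge0; last by rewrite invr_ge0 oppr_ge0.
  by rewrite rmorphN /= -pmulrn; lra.
have /andP[t1 t2] := Num.Theory.truncn_itv hK.
set n := Num.truncn _ in t1 t2.
exists (n * d)%N, (n%:Z * k + K)%R.
have -> : (n * d)%N%:R * x - y - (n%:Z * k + K)%:~R =
   (n%:R - (y + K%:~R) / delta) * delta.
  rewrite mulrBl divfK // /delta natrM rmorphD rmorphM /= -pmulrn; ring.
rewrite normrM; apply: le_lt_trans h; rewrite -[X in _ <= X]mul1r ler_wpM2r //.
by rewrite ler_norml; rewrite -natr1 in t2; apply/andP; split; lra.
Qed.

(** The orbit of [z] under an irrational rotation has a dense set of real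
    parts in [[- |z|, |z|]]. *)
Lemma rotation_Re_dense (w z : C) (v e : R) : cnorm w = 1 ->
  (forall M, (0 < M)%N -> w ^+ M != 1) -> `|v| <= cnorm z -> 0 < e ->
  exists l, `|complex.Re (w ^+ l * z) - v| < e.
Proof.
move=> w1 irr vz e0.
have [z0|z0] := eqVneq z 0.
  move: vz; rewrite z0 cnorm0 normr_le0 => /eqP ->.
  by exists 0%N; rewrite mulr0 subr0 normr0.
have r0 := cnorm_gt0 z0; set r := cnorm z in vz r0.
have [t wE] := polar1 w1; have [phi zE] := polar z.
have vr : -1 <= v / r <= 1.
  by rewrite -ler_norml normrM normfV (gtr0_norm r0) ler_pdivrMr ?mul1r.
have vE : v = r * cos (acos (v / r)) by rewrite acosK ?in_itv //= mulrC divfK ?gt_eqF.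
set psi := acos _ in vE.
have : \forall h \near psi, `|cos psi - cos h| < e / r.
  by have /cvgrPdist_lt := @continuous_cos R psi; apply; rewrite divr_gt0.
move=> /nbhs_ballP[d /= d0 hd].
have pi0 : 0 < 2 * pi :> R by rewrite mulr_gt0 ?pi_gt0.
have [||l [k hl]] := @multiples_mod1_dense (t / (2 * pi)) ((psi - phi) / (2 * pi))
    (d / (2 * pi)).
- by rewrite divr_gt0.
- move=> M k M0; apply: contra (irr M M0) => /eqP E.
  rewrite wE -cisMn -mulr_natl; apply/eqP.
  have -> : M%:R * t = 2 * pi * k%:~R by rewrite -E mulrCA [2 * pi * _]mulrC divfK // gt_eqF.
  exact: cis_2pi_int.
pose h := phi + l%:R * t - 2 * pi * k%:~R.
have hE : complex.Re (w ^+ l * z) = r * cos h.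
  rewrite {1}zE wE -cisMn mulrCA -cisD.
  have -> : cis (t *+ l + phi) = cis h.
    rewrite -[RHS]mulr1 -(cis_2pi_int k) -cisD subrK addrC.
    by rewrite mulr_natl.
  by rewrite /= mul0r subr0.
exists l; rewrite hE vE -mulrBr normrM gtr0_norm // mulrC -ltr_pdivlMr // distrC.
apply: hd; rewrite /ball /= distrC.
have -> : h - psi = (l%:R * (t / (2 * pi)) - (psi - phi) / (2 * pi) - k%:~R) * (2 * pi).
  by rewrite /h; have := lt0r_neq0 pi0; move: (2 * pi) => q q0; field.
by rewrite normrM (gtr0_norm pi0) -ltr_pdivlMr.
Qed.
End Rotation.

(** * The topology of the circle *)

Section CircleTopology.
Local Open Scope complex_scope.
Local Open Scope quotient_scope.
Local Open Scope ring_scope.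
Variable R : realType.
Local Notation cpi := (\pi_(circle R)).

Lemma cpiD (x y : R) : cpi (x + y) = cpi x + cpi y. Proof. exact: raddfD. Qed.
Lemma cpiN (x : R) : cpi (- x) = - cpi x. Proof. exact: raddfN. Qed.
Lemma cpiB (x y : R) : cpi (x - y) = cpi x - cpi y. Proof. exact: raddfB. Qed.

Lemma cpi_eq (x y : R) : cpi x = cpi y <-> exists k : int, x = y + k%:~R.
Proof.
split=> [/eqP|[k ->]].
  rewrite -Quotient.idealrBE => /intrP[k xyE]; exists k; rewrite -xyE; ring.
apply/eqP; rewrite -Quotient.idealrBE; apply/intrP; exists k; ring.
Qed.

Lemma cpi_eq0 (x : R) : cpi x = 0 <-> x \is a Num.int.
Proof.
have <- : cpi 0 = 0 by exact: raddf0.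
rewrite cpi_eq; split=> [[k ->]|/intrP[k ->]]; first by rewrite add0r intr_int.
by exists k; rewrite add0r.
Qed.

Lemma cpi_surj (x : circle R) : exists r, x = cpi r.
Proof. by exists (repr x); rewrite reprK. Qed.

Lemma nbhs_circleP (x : R) (U : set (circle R)) : nbhs (cpi x) U <->
  exists2 e, 0 < e & forall r, `|r| < e -> U (cpi (x + r)).
Proof.
split=> [|[e e0 eU]].
  rewrite nbhsE => -[V [oV Vx] VU].
  have : nbhs x (cpi @^-1` V).
    by apply: open_nbhs_nbhs; split; [exact: oV|exact: Vx].
  move=> /nbhs_ballP[e /= e0 eV]; exists e => // r re; apply/VU/eV.
  by rewrite /ball /= opprD addNKr normrN.
rewrite nbhsE; exists [set y | exists2 r, `|r| < e & y = cpi (x + r)].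
  split; last by exists 0; rewrite ?normr0 ?addr0.
  change (open (cpi @^-1` [set y | exists2 r, `|r| < e & y = cpi (x + r)])).
  rewrite openE => y [r re /cpi_eq[k ->]].
  apply/nbhs_ballP; exists (e - `|r|) => /=; first by rewrite subr_gt0.
  move=> z; rewrite /ball /= => zr; exists (z - k%:~R - x).
    rewrite -[z - k%:~R - x](subrK r); apply: le_lt_trans (ler_normD _ _) _.
    rewrite -ltrBrDr distrC; apply: le_lt_trans zr; rewrite le_eqVlt; apply/orP; left.
    by apply/eqP; congr `|_|; ring.
  by apply/cpi_eq; exists k; ring.
by move=> _ [r re ->]; apply: eU.
Qed.

Lemma continuous_cpi : continuous (cpi : R -> circle R).
Proof.
move=> x U /nbhs_circleP[e e0 eU]; apply/nbhs_ballP; exists e => //= y.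
rewrite /ball /= distrC => yx; rewrite -[y](subrK x) addrC; exact: eU.
Qed.

Lemma compact_circle : compact [set: circle R].
Proof.
have -> : [set: circle R] = cpi @` `[0, 1]%classic.
  rewrite eqEsubset; split=> // x _; have [r ->] := cpi_surj x.
  exists (r - (Num.floor r)%:~R).
    rewrite /= in_itv /=; have := floor_itv r; rewrite rmorphD /= => /andP[]; lra.
  by apply/cpi_eq; exists (- Num.floor r); rewrite rmorphN.
apply: continuous_compact; last exact: segment_compact.
by apply: continuous_subspaceT; exact: continuous_cpi.
Qed.

Lemma hausdorff_circle : hausdorff_space (circle R).
Proof.
move=> p q; have [x ->] := cpi_surj p; have [y ->] := cpi_surj q => cl.
set z := y - x; set f := Num.floor z.
have /andP[f1 f2] := floor_itv z; rewrite -/f rmorphD /= in f1 f2.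
have [f0|f0] := eqVneq (z - f%:~R) 0.
  apply/esym/cpi_eq; exists f; rewrite /z in f0; lra.
have fp : 0 < z - f%:~R by rewrite lt_def f0; lra.
pose e := Num.min (z - f%:~R) (1 - (z - f%:~R)) / 2.
have e0 : 0 < e by rewrite divr_gt0 // lt_min fp; lra.
have e1 : 2 * e <= z - f%:~R by rewrite /e mulrC divfK // ge_min lexx.
have e2 : 2 * e <= 1 - (z - f%:~R) by rewrite /e mulrC divfK // ge_min lexx orbT.
pose B (t : R) := [set w | exists2 r, `|r| < e & w = cpi (t + r)].
have nB t : nbhs (cpi t) (B t) by apply/nbhs_circleP; exists e => // r re; exists r.
have [_ [[r re ->] [s se /cpi_eq[k kE]]]] := cl _ _ (nB x) (nB y).
exfalso; move: re se; rewrite !ltr_norml => /andP[r1 r2] /andP[s1 s2].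
have zE : z + k%:~R = r - s by rewrite /z; lra.
have [kf|kf] := leP (f + k) (-1).
  have : (f + k)%:~R <= (-1)%:~R :> R by rewrite ler_int.
  rewrite rmorphD rmorphN /=; lra.
have {}kf : 0 <= f + k by move: (f + k)%R kf => j; clear; lia.
have : 0%:~R <= (f + k)%:~R :> R by rewrite ler_int.
rewrite rmorphD /=; lra.
Qed.

Lemma circle_cvgD (T : Type) (F : set_system T) (f g : T -> circle R) x y :
  ProperFilter F -> f @ F --> x -> g @ F --> y -> (fun t => f t + g t) @ F --> x + y.
Proof.
move=> FF fx gy U; have [a aE] := cpi_surj x; have [b bE] := cpi_surj y; subst.
rewrite -cpiD => /nbhs_circleP[e e0 eU].
pose B (t : R) := [set w | exists2 r, `|r| < e / 2 & w = cpi (t + r)].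
have nB t : nbhs (cpi t) (B t).
  by apply/nbhs_circleP; exists (e / 2); rewrite ?divr_gt0 // => r re; exists r.
have FAB : F (f @^-1` B a `&` g @^-1` B b).
  by apply: filterI; [exact: (fx _ (nB a))|exact: (gy _ (nB b))].
have sub : f @^-1` B a `&` g @^-1` B b `<=` (fun t => f t + g t) @^-1` U.
  move=> t [/= [r re rE] [u ue uE]].
  rewrite rE uE -cpiD addrACA; apply: eU; apply: le_lt_trans (ler_normD _ _) _; lra.
exact: filterS sub FAB.
Qed.
End CircleTopology.

(** * The topology of the dual of A *)

Section DualTopology.
Local Open Scope complex_scope.
Local Open Scope quotient_scope.
Local Open Scope ring_scope.
Variable R : realType.
Local Notation C := R[i].
Local Notation "'ZI'" := (@gaussian R).
Local Notation cnorm := (@Normc.normc R).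
Local Notation cpi := (\pi_(circle R)).
Local Notation D := (Dbar R).
Implicit Types (a b : ringA R) (w chi psi : hatA R) (z : C) (c : nat).

(** [a] belongs to the lattice [D ^- c Z[i]] of [A]. *)
Definition level c a : bool := val a * D ^+ c \in ZI.

Lemma level_ex a : exists c, level c a.
Proof.
have /asboolP[g [m [n [gZ aE]]]] := valP a.
exists (m + n)%N; rewrite /level.
have DE : D ^+ (m + n) = ((P5 R)^* ^+ m * (P13 R)^* ^+ n) * ((P5 R)^* ^+ n * (P13 R)^* ^+ m).
  by rewrite mulrACA [X in _ * X]mulrC -!exprD -exprMn.
have den0 : (P5 R)^* ^+ m * (P13 R)^* ^+ n != 0.
  by rewrite mulf_neq0 // expf_neq0 ?P5_conj_neq0 ?P13_conj_neq0.
have aE' : val a * ((P5 R)^* ^+ m * (P13 R)^* ^+ n) = g by rewrite aE; exact: divfK.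
rewrite DE (mulrA (val a)) aE'.
by rewrite rpredM // rpredM // rpredX ?P5_conj_gaussian ?P13_conj_gaussian.
Qed.

Lemma level_mono c c' a : (c <= c')%N -> level c a -> level c' a.
Proof.
move=> cc' H; rewrite /level -(subnKC cc') exprD mulrA.
by apply: rpredM => //; apply: rpredX; apply: D_gaussian.
Qed.

Lemma level_elem c (g : C) : g \in ZI -> exists2 a, val a = g / D ^+ c & level c a.
Proof.
move=> gZ; have aP : g / D ^+ c \in @locZi R.
  by apply/asboolP; exists g, c, c; rewrite DbarE exprMn.
exists (RingA aP); rewrite // /level /= divfK //.
by apply: expf_neq0; apply: D_neq0.
Qed.

(** [agree c w z]: the characters [w] and [jC z] coincide on the lattice
    [D ^- c Z[i]] of [A]; these lattices exhaust [A]. *)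
Definition agree c w z : Prop := forall a, level c a -> w a = jC z a.

Lemma jCE z a : jC z a = cpi (complex.Re (z * val a)). Proof. by []. Qed.

Lemma hatA_ext w w' : w =1 w' -> w = w'. Proof. exact: pdual_ext. Qed.
Lemma hatADE w w' a : (w + w') a = w a + w' a. Proof. by []. Qed.
Lemma hatANE w a : (- w) a = - w a. Proof. by []. Qed.
Lemma hatABE w w' a : (w - w') a = w a - w' a. Proof. by []. Qed.
Lemma hatA0E a : (0 : hatA R) a = 0. Proof. by []. Qed.
Lemma hatAMnE w n a : (w *+ n) a = w a *+ n.
Proof. by elim: n => [|n IH]; rewrite ?mulr0n // !mulrS hatADE IH. Qed.

(** Explicit form of [agree_ex]: [w] agrees on [D ^- c Z[i]] with the point of the
    line given by lifts of its values at the two generators. *)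
Lemma agree_lift c w r1 r2 b1 b2 :
  val b1 = 1 / D ^+ c -> val b2 = 'i%C / D ^+ c -> w b1 = cpi r1 -> w b2 = cpi r2 ->
  agree c w ((r1 +i* (- r2)) * D ^+ c).
Proof.
move=> b1E b2E w1 w2 a /gaussianP[x [y aE]].
have Dc0 : D ^+ c != 0 by apply: expf_neq0; apply: D_neq0.
have aE' : a = b1 *~ x + b2 *~ y.
  apply: val_inj; rewrite raddfD !raddfMz /= b1E b2E -[LHS](mulfK Dc0) aE.
  by rewrite -[X in _ = X + _]mulrzl -[X in _ = _ + X]mulrzl mul1r mulrDl mulrA.
rewrite jCE mulrAC -mulrA aE.
have -> : w a = cpi (r1 *~ x + r2 *~ y) by rewrite aE' !raddfD !raddfMz w1 w2.
congr cpi.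
have cE (k : int) : k%:~R = (k%:~R : R)%:C :> C by rewrite rmorph_int.
rewrite !cE /= -[r1 *~ _]mulrzr -[r2 *~ _]mulrzr; ring.
Qed.

Lemma agree_ex c w : exists z, agree c w z.
Proof.
have [b1 b1E _] := level_elem c (rpred1 _); have [b2 b2E _] := level_elem c (gaussian_i R).
have [r1 r1E] := cpi_surj (w b1); have [r2 r2E] := cpi_surj (w b2).
by exists ((r1 +i* (- r2)) * D ^+ c); apply: agree_lift r1E r2E.
Qed.

(** The [z] for which [jC z] is given on [D ^- c Z[i]] form a class modulo
    [D ^+ c Z[i]]. *)
Lemma agree_gdvd c z z' : agree c (jC z) z' <-> gdvd (D ^+ c) (z - z').
Proof.
have Dc0 : D ^+ c != 0 by apply: expf_neq0; apply: D_neq0.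
split=> [H|[h hZ E] a ca]; last first.
  rewrite !jCE -(subrK z' z) E mulrDl raddfD /= cpiD.
  suff /cpi_eq0 -> : complex.Re (D ^+ c * h * val a) \is a Num.int by rewrite add0r.
  have : D ^+ c * h * val a \in ZI.
    by rewrite mulrAC mulrC [D ^+ c * _]mulrC; apply: rpredM.
  by move=> /andP[].
have [b1 b1E l1] := level_elem c (rpred1 _).
have [b2 b2E l2] := level_elem c (gaussian_i R).
exists ((z - z') / D ^+ c); last by rewrite mulrC divfK.
have h1 := H _ l1; have h2 := H _ l2.
have int b : jC z b = jC z' b -> complex.Re ((z - z') * val b) \is a Num.int.
  rewrite !jCE mulrBl raddfB /= => E; apply/cpi_eq0; rewrite cpiB E subrr //.
move: (int _ h1) (int _ h2); rewrite b1E b2E mul1r mulrCA.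
case: (_ / _) => x y /= ix; rewrite mul0r mul1r sub0r rpredN => iy.
by rewrite unfold_in /= ix.
Qed.

Lemma agreeD c w w' z z' : agree c w z -> agree c w' z' -> agree c (w + w') (z + z').
Proof.
by move=> H H' a ca; rewrite hatADE (H _ ca) (H' _ ca) !jCE mulrDl raddfD cpiD.
Qed.
Lemma agreeN c w z : agree c w z -> agree c (- w) (- z).
Proof. by move=> H a ca; rewrite hatANE (H _ ca) !jCE mulNr raddfN cpiN. Qed.
Lemma agreeB c w w' z z' : agree c w z -> agree c w' z' -> agree c (w - w') (z - z').
Proof. by move=> H H'; apply: agreeD => //; apply: agreeN. Qed.
Lemma agree_mono c c' w z : (c <= c')%N -> agree c' w z -> agree c w z.
Proof. by move=> cc' H a /(level_mono cc')/H. Qed.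

(** [near0 c e w]: on [D ^- c Z[i]], [w] is a point [jC z] with [|z| < e]. These sets
    form a basis of neighborhoods of [0]. *)
Definition near0 c (e : R) w : Prop := exists2 z, cnorm z < e & agree c w z.

Lemma near0_mono c c' e e' w : (c <= c')%N -> e' <= e -> near0 c' e' w -> near0 c e w.
Proof.
by move=> cc' ee' [z ze H]; exists z; [apply: lt_le_trans ee'|apply: agree_mono H].
Qed.

Lemma continuous_eval a : continuous (fun chi => chi a : circle R).
Proof.
move=> chi U Ua.
have /= := @proj_continuous _ (fun _ : ringA R => circle R) a (pdual_ptws chi) U Ua.
exact: (@initial_continuous _ _ (@pdual_ptws R (ringA R))).
Qed.

Lemma hatA_cvg (F : set_system (hatA R)) chi : Filter F ->
  (forall a, (fun psi => psi a : circle R) @ F --> chi a) -> F --> chi.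
Proof.
move=> FF H.
have : (@pdual_ptws R (ringA R)) @ F --> (pdual_ptws chi : {ptws ringA R -> circle R}).
  apply/cvg_sup => a U [V [[W oW <-] WV]] VU.
  apply: (filterS (fun f => VU f)).
  by apply: (H a); apply: open_nbhs_nbhs; split.
move=> H' A [_ [[B oB <-] Bchi BA]].
have FB : ((@pdual_ptws R (ringA R)) @ F) B.
  by apply: H'; apply: open_nbhs_nbhs.
exact: (filterS BA FB).
Qed.

Lemma nbhs_hatAP chi (U : set (hatA R)) : nbhs chi U <->
  exists c e, 0 < e /\ forall psi, near0 c e (psi - chi) -> U psi.
Proof.
split=> [Uchi|[c [e [e0 H]]]].
  pose N := filter_from [set p : nat * R | 0 < p.2]
    (fun p => [set psi | near0 p.1 p.2 (psi - chi)]).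
  have NF : Filter N.
    apply: filter_from_filter; first by exists (0%N, 1) => /=.
    move=> [c e] [c' e'] /= e0 e'0; exists (maxn c c', Num.min e e').
      by rewrite /= lt_min e0.
    by move=> psi /= h; split; apply: near0_mono h; rewrite ?leq_maxl ?leq_maxr ?ge_min ?lexx ?orbT.
  suff : N --> chi by move=> /(_ _ Uchi)[[c e] /= e0 h]; exists c, e.
  apply: hatA_cvg => a V; have [x xE] := cpi_surj (chi a); rewrite xE.
  move=> /nbhs_circleP[d d0 dV]; have [c ca] := level_ex a.
  have n0 : 0 < cnorm (val a) + 1 by rewrite ltr_wpDl ?cnorm_ge0.
  exists (c, d / (cnorm (val a) + 1)); first by rewrite /= divr_gt0.
  move=> psi /= [z ze /(_ _ ca)]; rewrite hatABE jCE => E.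
  have -> : psi a = cpi (x + complex.Re (z * val a)).
    by rewrite cpiD -E -xE addrC subrK.
  apply: dV; apply: le_lt_trans (cnorm_Re _) _; rewrite cnormM.
  have a0 := cnorm_ge0 (val a); have z0 := cnorm_ge0 z.
  rewrite ltr_pdivlMr // in ze; nra.
have [b1 b1E l1] := level_elem c (rpred1 _).
have [b2 b2E l2] := level_elem c (gaussian_i R).
have Dc0 : 0 < cnorm (D ^+ c) by apply/cnorm_gt0/expf_neq0/D_neq0.
pose d := e / 2 / cnorm (D ^+ c); have d0 : 0 < d by rewrite !divr_gt0.
pose B b := [set w : circle R | exists2 r, `|r| < d & w = chi b + cpi r].
have nB b : nbhs chi [set psi | B b (psi b)].
  have [x xE] := cpi_surj (chi b); apply: (continuous_eval (a := b)).
  by rewrite xE; apply/nbhs_circleP; exists d => // r rd; exists r; rewrite // xE cpiD.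
apply: filterS (filterI (nB b1) (nB b2)) => psi [[r1 r1d r1E] [r2 r2d r2E]].
apply: H; exists ((r1 +i* (- r2)) * D ^+ c).
  rewrite cnormM -ltr_pdivlMr //; apply: le_lt_trans (cnorm_ReIm _ _) _.
  by rewrite normrN; apply: lt_le_trans (ltrD r1d r2d) _; rewrite /d; lra.
by apply: (agree_lift b1E b2E); rewrite hatABE ?r1E ?r2E addrAC subrr add0r.
Qed.

Lemma hausdorff_hatA : hausdorff_space (hatA R).
Proof.
move=> chi psi cl; apply: hatA_ext => a; apply: hausdorff_circle => U V Ua Va.
have [w [wU wV]] := cl _ _ (continuous_eval Ua) (continuous_eval Va).
by exists (w a).
Qed.

(** An ultrafilter converges at each [a], by compactness of the circle, and the
    pointwise limit is additive. *)
Lemma compact_hatA : compact [set: hatA R].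
Proof.
rewrite compact_ultra => F FU _.
have lim a : exists x : circle R, (fun psi : hatA R => psi a : circle R) @ F --> x.
  have PF : ProperFilter ((fun psi : hatA R => psi a : circle R) @ F).
    exact: fmap_proper_filter.
  have UF : UltraFilter ((fun psi : hatA R => psi a : circle R) @ F).
    split=> // G GF sG; rewrite eqEsubset; split=> // B GB.
    have [//|FB] := in_ultra_setVsetC ((fun psi : hatA R => psi a : circle R) @^-1` B) FU.
    have GnB : G (~` B) by apply: sG.
    by exfalso; apply: (@filter_not_empty _ G _); rewrite -(setICr B); apply: filterI.
  have := @compact_circle R; rewrite compact_ultra => /(_ _ UF filterT)[x [_ H]].
  by exists x.
pose f a := sval (cid (lim a)).
have fP a : (fun psi : hatA R => psi a : circle R) @ F --> f a := svalP (cid (lim a)).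
have uniq (x y : circle R) a : (fun psi : hatA R => psi a : circle R) @ F --> x ->
   (fun psi : hatA R => psi a : circle R) @ F --> y -> x = y.
  have PF : ProperFilter ((fun psi : hatA R => psi a : circle R) @ F).
    exact: fmap_proper_filter.
  move=> hx hy; have H := @cvg_unique (circle R) (@hausdorff_circle R) _ PF.
  by apply: H; [exact: hx|exact: hy].
have fB : zmod_morphism f.
  move=> a b; apply/eqP; rewrite eq_sym subr_eq; apply/eqP.
  have H := circle_cvgD ultra_proper (fP (a - b)) (fP b).
  have E : (fun psi : hatA R => psi (a - b) + psi b : circle R) = (fun psi => psi a).
    by apply/funext => psi; rewrite -raddfD subrK.
  by rewrite E in H; exact: (uniq _ _ a (fP a) (H FU)).
pose chi : hatA R := HB.pack f (GRing.isZmodMorphism.Build _ _ _ fB).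
by exists chi; split=> //; apply: hatA_cvg.
Qed.
End DualTopology.

(** * The action of Theta *)

Section Dynamics.
Local Open Scope complex_scope.
Local Open Scope quotient_scope.
Local Open Scope ring_scope.
Variable R : realType.
Local Notation C := R[i].
Local Notation "'ZI'" := (@gaussian R).
Local Notation cnorm := (@Normc.normc R).
Local Notation cpi := (\pi_(circle R)).
Local Notation D := (Dbar R).
Implicit Types (a b t : ringA R) (w chi psi : hatA R) (z : C) (c : nat).

Lemma closed_hatA (Y : set (hatA R)) chi : closed Y ->
  (forall c e, 0 < e -> exists2 y, Y y & near0 c e (y - chi)) -> Y chi.
Proof.
move=> cY H; apply: cY => U /nbhs_hatAP[c [e [e0 eU]]].
by have [y Yy ny] := H c e e0; exists y; split=> //; apply: eU.
Qed.

Lemma actE t chi a : act t chi a = chi (t * a). Proof. by []. Qed.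
Lemma actD t chi psi : act t (chi + psi) = act t chi + act t psi.
Proof. exact: hatA_ext. Qed.
Lemma actN t chi : act t (- chi) = - act t chi.
Proof. exact: hatA_ext. Qed.
Lemma actB t chi psi : act t (chi - psi) = act t chi - act t psi.
Proof. by rewrite actD actN. Qed.
Lemma actMn t chi n : act t (chi *+ n) = act t chi *+ n.
Proof. by apply: hatA_ext => a; rewrite actE !hatAMnE. Qed.
Lemma act_mul t t' chi : act (t * t') chi = act t (act t' chi).
Proof. by apply: hatA_ext => a; rewrite !actE mulrA [t' * t]mulrC. Qed.
Lemma act1 chi : act 1 chi = chi.
Proof. by apply: hatA_ext => a; rewrite actE mul1r. Qed.
Lemma act_jC t z : act t (jC z) = jC (z * val t).
Proof. by apply: hatA_ext => a; rewrite actE !jCE rmorphM mulrA. Qed.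
Lemma jCD z z' : jC (z + z') = jC z + jC z'.
Proof. by apply: hatA_ext => a; rewrite hatADE !jCE mulrDl raddfD cpiD. Qed.
Lemma jCN z : jC (- z) = - jC z.
Proof. by apply: hatA_ext => a; rewrite hatANE !jCE mulNr raddfN cpiN. Qed.
Lemma jCB z z' : jC (z - z') = jC z - jC z'.
Proof. by rewrite jCD jCN. Qed.

(** The elements of [Theta]. *)
Definition thetaX (r s : nat) : ringA R := theta5 R ^+ r * theta13 R ^+ s.

Lemma val_thetaX r s : val (thetaX r s) = (P5 R / (P5 R)^*) ^+ r * (P13 R / (P13 R)^*) ^+ s.
Proof. by rewrite rmorphM !rmorphXn. Qed.

Lemma thetaXM r s r' s' : thetaX r s * thetaX r' s' = thetaX (r + r') (s + s').
Proof. by rewrite /thetaX !exprD mulrACA. Qed.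

Lemma thetaX00 : thetaX 0 0 = 1. Proof. by rewrite /thetaX !expr0 mulr1. Qed.

Lemma cnorm_rot (P : C) : P != 0 -> cnorm (P / P^*) = 1.
Proof.
by move=> P0; rewrite cnormM cnormV cnorm_conj divff // gt_eqF // cnorm_gt0.
Qed.

Lemma P5_neq0 : P5 R != 0.
Proof. by rewrite -conjC_eq0; apply: P5_conj_neq0. Qed.
Lemma P13_neq0 : P13 R != 0.
Proof. by rewrite -conjC_eq0; apply: P13_conj_neq0. Qed.

Lemma cnorm_thetaX r s : cnorm (val (thetaX r s)) = 1.
Proof.
rewrite val_thetaX cnormM !cnormX cnorm_rot ?P5_neq0 // cnorm_rot ?P13_neq0 //.
by rewrite !expr1n mulr1.
Qed.

Lemma thetaX_neq0 r s : thetaX r s != 0.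
Proof.
apply/eqP => th0; have := cnorm_thetaX r s; rewrite th0 rmorph0 cnorm0.
by move/eqP; rewrite eq_sym oner_eq0.
Qed.

Lemma rot_level (P : C) k r : P \in ZI -> P^* \in ZI -> P^* != 0 -> (r <= k)%N ->
  (P / P^*) ^+ r * (P^* ) ^+ k \in ZI.
Proof.
move: P^* => P' PZ P'Z P'0 rk; rewrite -(subnKC rk) exprD mulrA -exprMn divfK //.
by rewrite rpredM ?rpredX.
Qed.

Lemma level_thetaX c k r s a : (r <= k)%N -> (s <= k)%N -> level c a ->
  level (c + k) (thetaX r s * a).
Proof.
move=> rk sk ca; have valM : val (thetaX r s * a) = val (thetaX r s) * val a by exact: rmorphM.
rewrite /level valM val_thetaX exprD.
have h5 := rot_level (P5_gaussian R) (P5_conj_gaussian R) (P5_conj_neq0 R) rk.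
have h13 := rot_level (P13_gaussian R) (P13_conj_gaussian R) (P13_conj_neq0 R) sk.
have DE : D ^+ k = (P5 R)^* ^+ k * (P13 R)^* ^+ k by rewrite -exprMn.
have aux (x y x' y' v d : C) : x * x' \in ZI -> y * y' \in ZI -> v * d \in ZI ->
    x * y * v * (d * (x' * y')) \in ZI.
  move=> hx hy hv.
  have -> : x * y * v * (d * (x' * y')) = (x * x') * (y * y') * (v * d) by ring.
  by apply: rpredM => //; apply: rpredM.
by rewrite DE; exact: aux h5 h13 ca.
Qed.

(** Acting by [thetaX r s] rotates the local coordinate [z], at the cost of [k] levels. *)
Lemma agree_act c k r s w z : (r <= k)%N -> (s <= k)%N -> agree (c + k) w z ->
  agree c (act (thetaX r s) w) (z * val (thetaX r s)).
Proof.
move=> rk sk H a ca; rewrite actE (H _ (level_thetaX rk sk ca)).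
by rewrite -act_jC.
Qed.

Lemma agree_shift c w z z' : agree c w z -> gdvd (D ^+ c) (z - z') -> agree c w z'.
Proof. by move=> H /agree_gdvd H' a ca; rewrite (H a ca) (H' a ca). Qed.

(** Invariance under the subsemigroup of [N]-th powers of [Theta]. *)
Definition thetaX_invariant N (Q : set (hatA R)) : Prop :=
  forall r s chi, Q chi -> Q (act (thetaX (N * r) (N * s)) chi).

(** A closed invariant set that accumulates at [0] off the line [jC C] is the whole
    dual. On a deep lattice, a point of the set near [0] and off the line agrees with
    [jC w], where [w - z] is a Gaussian integer divisible by a high but bounded power
    of [D] and [z] is small, so that [orbit_dense] applies to [w - z]. *)
Lemma invariant_full N (Q : set (hatA R)) : (0 < N)%N -> closed Q -> thetaX_invariant N Q ->
  (forall c e, 0 < e -> exists q, [/\ Q q, near0 c e q & forall z, q <> jC z]) ->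
  forall chi, Q chi.
Proof.
move=> N0 cQ iQ bad chi; apply: (closed_hatA cQ) => c e e0.
have e2 : 0 < e / 2 by rewrite divr_gt0.
have [tau tauP] := agree_ex c chi.
have [m [C0 dense]] := orbit_dense c tau N0 e2.
have [q [Qq [z ze qz] qnz]] := bad m _ e2.
have [a qa] : exists a, q a <> jC z a.
  apply: contrapT => H; apply: (qnz z); apply: hatA_ext => a.
  by apply: contrapT => Ha; apply: H; exists a.
have [n0 na0] := level_ex a.
pose n := maxn n0 m; have na : level n a by apply: level_mono na0; rewrite leq_maxl.
(* The level [c + k] is deep enough for all exponents allowed by [orbit_dense]. *)
pose k := (N * (n + C0))%N.
have [w qw] := agree_ex (c + k + n) q.
have [||r [s [g [rn sn gZ close]]]] := dense n (w - z).
- apply/agree_gdvd => b mb; rewrite -(qz b mb); apply/esym/qw.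
  by apply: level_mono mb; rewrite (leq_trans (leq_maxr n0 m)) // leq_addl.
- move/agree_gdvd/(_ _ na) => E; apply: qa; rewrite -E; apply: qw.
  by apply: level_mono na; rewrite leq_addl.
exists (act (thetaX (N * r) (N * s)) q); first exact: iQ.
set t := thetaX _ _; exists (w * val t - tau + D ^+ c * g).
  have -> : w * val t - tau + D ^+ c * g =
     z * val t + ((w - z) * val t + D ^+ c * g - tau) by ring.
  apply: le_lt_trans (cnormD _ _) _; rewrite cnormM cnorm_thetaX mulr1 [e]splitr.
  by apply: ltrD => //; rewrite val_thetaX mulrA.
apply: (agree_shift (z := w * val t - tau)).
  apply: agreeB => //; apply: (agree_act (k := k)); rewrite ?leq_mul //.
  by apply: agree_mono qw; rewrite leq_addr.
exists (- g); first by rewrite rpredN.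
ring.
Qed.
End Dynamics.

(** * Torsion characters *)

Section Torsion.
Local Open Scope complex_scope.
Local Open Scope quotient_scope.
Local Open Scope ring_scope.
Variable R : realType.
Local Notation C := R[i].
Local Notation "'ZI'" := (@gaussian R).
Local Notation cnorm := (@Normc.normc R).
Local Notation cpi := (\pi_(circle R)).
Local Notation D := (Dbar R).
Implicit Types (a b t : ringA R) (w chi psi u : hatA R) (z : C) (c : nat).

Lemma gaussian_elem (g : C) : g \in ZI -> exists a, val a = g.
Proof.
by move=> /(level_elem 0)[a aE _]; exists a; rewrite aE expr0 divr1.
Qed.

Lemma gaussian_residue n (g : C) : (0 < n)%N -> g \in ZI ->
  exists v : 'I_n * 'I_n, exists2 h, h \in ZI & g = v.1%:R + v.2%:R * 'i%C + h *+ n.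
Proof.
case: n => // n _ /gaussianP[x [y ->]].
have res (k : int) : exists v : 'I_n.+1, exists l : int, k = v%:Z + l * n.+1%:Z.
  have n0 : n.+1%:Z != 0 by [].
  have km : (absz (modz k n.+1) < n.+1)%N.
    by rewrite -ltz_nat gez0_abs ?modz_ge0 // ltz_mod.
  exists (Ordinal km), (divz k n.+1); rewrite /= gez0_abs ?modz_ge0 //.
  by rewrite {1}(divz_eq k n.+1) addrC.
have [v [l ->]] := res x; have [v' [l' ->]] := res y.
exists (v, v'), (l%:~R + l'%:~R * 'i%C).
  by rewrite rpredD ?rpredM ?gaussian_int ?gaussian_i.
rewrite !rmorphD !rmorphM /= -!pmulrn -mulr_natr; ring.
Qed.

(** [A / n A] is finite, so the powers of [g / d] modulo [n] are eventually periodic;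
    [d'] is the inverse of [d]. *)
Lemma pow_cycle (g d d' : ringA R) n : val g \in ZI -> val d \in ZI -> d * d' = 1 ->
  (0 < n)%N -> exists j p a, (0 < p)%N /\ (g * d') ^+ (j + p) = (g * d') ^+ j + a *+ n.
Proof.
move=> gZ dZ dd' n0.
pose rs (x : ringA R) (v : 'I_n * 'I_n) := exists b e : ringA R,
  val b = v.1%:R + v.2%:R * 'i%C /\ x = b + e *+ n.
have res x : val x \in ZI -> {v | rs x v}.
  move=> xZ; apply: cid; have [v [h hZ E]] := gaussian_residue n0 xZ.
  have [e eE] := gaussian_elem hZ.
  have [|b bE] := @gaussian_elem (v.1%:R + v.2%:R * 'i%C).
    by rewrite rpredD ?rpredM ?rpred_nat ?gaussian_i.
  exists v, b, e; split=> //; apply: val_inj.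
  by rewrite rmorphD rmorphMn /= bE eE.
have gX j : val (g ^+ j) \in ZI by rewrite rmorphXn rpredX.
have dX j : val (d ^+ j) \in ZI by rewrite rmorphXn rpredX.
(* If [g ^+ j] and [d ^+ j] return simultaneously, so does [(g / d) ^+ j]. *)
have [j [j' [jj' [E1 E2]]]] := pigeonhole_fin
  (fun j => (sval (res _ (gX j)), sval (res _ (dX j)))).
have same x y (hx : val x \in ZI) (hy : val y \in ZI) :
    sval (res x hx) = sval (res y hy) -> exists e, y = x + e *+ n.
  case: (svalP (res x hx)) => b [e [bE xE]]; case: (svalP (res y hy)) => b' [e' [bE' yE]] E.
  exists (e' - e); rewrite xE yE; have -> : b' = b by apply: val_inj; rewrite bE bE' E.
  by rewrite -addrA -mulrnDl [e + _]addrC subrK.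
have [e1 gE] := same _ _ _ _ E1; have [e2 dE] := same _ _ _ _ E2.
exists j, (j' - j)%N, ((e1 * d ^+ j - g ^+ j * e2) * d' ^+ (j + j')).
rewrite subn_gt0 jj' subnKC ?(ltnW jj') //; split=> //.
have dd'X k : d ^+ k * d' ^+ k = 1 by rewrite -exprMn dd' expr1n.
have L : (g * d') ^+ j' = g ^+ j' * d ^+ j * d' ^+ (j + j').
  by rewrite exprMn exprD -mulrA (mulrA (d ^+ j)) dd'X mul1r.
have L' : (g * d') ^+ j = g ^+ j * d ^+ j' * d' ^+ (j + j').
  by rewrite exprMn [(j + j')%N]addnC exprD -mulrA (mulrA (d ^+ j')) dd'X mul1r.
rewrite L L' gE dE -(mulr_natr e1 n) -(mulr_natr e2 n) -(mulr_natr (_ * d' ^+ (j + j')) n).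
ring.
Qed.

Lemma theta_cycle n : (0 < n)%N -> exists j p a j' p' a', [/\ (0 < p)%N, (0 < p')%N,
  theta5 R ^+ (j + p) = theta5 R ^+ j + a *+ n &
  theta13 R ^+ (j' + p') = theta13 R ^+ j' + a' *+ n].
Proof.
move=> n0.
have cyc (P P' Q : C) (t : ringA R) : P \in ZI -> P' \in ZI -> Q \in ZI -> P' * Q = D ->
    val t = P / P' -> exists j p a, (0 < p)%N /\ t ^+ (j + p) = t ^+ j + a *+ n.
  move=> PZ P'Z QZ PQ tE.
  have P'0 : P' != 0.
    by apply/eqP => P0; have := D_neq0 R; rewrite -PQ P0 mul0r eqxx.
  have [g gE] := gaussian_elem PZ; have [d dE] := gaussian_elem P'Z.
  have [d' d'E _] := level_elem 1 QZ.
  have dV : val d' = P'^-1.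
    rewrite d'E expr1 -PQ invfM mulrCA divff ?mulr1 //.
    by apply/eqP => Q0; have := D_neq0 R; rewrite -PQ Q0 mulr0 eqxx.
  have -> : t = g * d' by apply: val_inj; rewrite rmorphM /= gE dV.
  apply: (@pow_cycle g d d' n) => //; first by rewrite gE.
    by rewrite dE.
  by apply: val_inj; rewrite rmorphM rmorph1 /= dE dV divff.
have [j [p [a [p0 E]]]] := cyc _ _ _ (theta5 R) (P5_gaussian R) (P5_conj_gaussian R)
  (P13_conj_gaussian R) erefl erefl.
have [j' [p' [a' [p'0 E']]]] := cyc _ _ _ (theta13 R) (P13_gaussian R)
  (P13_conj_gaussian R) (P5_conj_gaussian R) (mulrC _ _) erefl.
by exists j, p, a, j', p', a'.
Qed.

Lemma act_torsion u n t t' a : u *+ n = 0 -> t' = t + a *+ n -> act t' u = act t u.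
Proof.
move=> un ->; apply: hatA_ext => b.
rewrite !actE mulrDl raddfD -mulr_natr mulrAC mulr_natr raddfMn -hatAMnE un hatA0E.
by rewrite addr0.
Qed.

(** Some image of a torsion point is fixed by all [N]-th powers of [Theta]. *)
Lemma torsion_fixed u n : (0 < n)%N -> u *+ n = 0 -> exists r0 s0 N, (0 < N)%N /\
  forall r s, act (thetaX R (N * r) (N * s)) (act (thetaX R r0 s0) u) = act (thetaX R r0 s0) u.
Proof.
move=> n0 un; have [j [p [a [j' [p' [a' [p0 p'0 E E']]]]]]] := theta_cycle n0.
exists j, j', (p * p')%N; rewrite muln_gt0 p0; split=> // r s.
have fix5 k v : act (theta5 R ^+ (j + p * k)) (act v u) = act (theta5 R ^+ j) (act v u).
  have vn : act v u *+ n = 0 by rewrite -actMn un; apply: hatA_ext => b; rewrite actE !hatA0E.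
  elim: k => [|k IH]; first by rewrite muln0 addn0.
  rewrite mulnS addnA exprD [_ ^+ (j + p) * _]mulrC act_mul (act_torsion _ E).
    by rewrite -act_mul -exprD addnC.
  by rewrite vn.
have fix13 k v : act (theta13 R ^+ (j' + p' * k)) (act v u) =
    act (theta13 R ^+ j') (act v u).
  have vn : act v u *+ n = 0 by rewrite -actMn un; apply: hatA_ext => b; rewrite actE !hatA0E.
  elim: k => [|k IH]; first by rewrite muln0 addn0.
  rewrite mulnS addnA exprD [_ ^+ (j' + p') * _]mulrC act_mul (act_torsion _ E').
    by rewrite -act_mul -exprD addnC.
  by rewrite vn.
rewrite -act_mul thetaXM [(_ + j)%N]addnC [(_ + j')%N]addnC -[(p * p' * r)%N]mulnA.
rewrite [(p * p')%N]mulnC -[(p' * p * s)%N]mulnA /thetaX.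
rewrite act_mul fix5 -act_mul (mulrC (theta5 R ^+ j)) (act_mul (theta13 R ^+ _)) fix13.
by rewrite -act_mul (mulrC (theta13 R ^+ j')).
Qed.

(** The [2 ^ k]-th powers of [Theta] are [1] modulo [2 ^ k], hence fix all
    [2 ^ k]-torsion points. *)
Lemma thetaX_pow2 k r s : exists a, thetaX R (2 ^ k * r) (2 ^ k * s) = 1 + a *+ (2 ^ k).
Proof.
have one (g x : ringA R) m : (exists a, x = 1 + a *+ m) -> exists a, x * g ^+ 0 = 1 + a *+ m.
  by move=> [a aE]; exists a; rewrite expr0 mulr1.
have mul m x y : (exists a, x = 1 + a *+ m) -> (exists a, y = 1 + a *+ m) ->
    exists a : ringA R, x * y = 1 + a *+ m.
  move=> [a ->] [b ->]; exists (a + b + a * b *+ m).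
  rewrite -(mulr_natr a m) -(mulr_natr b m) -(mulr_natr (_ + _) m) -(mulr_natr (a * b) m).
  ring.
have pow m x j : (exists a, x = 1 + a *+ m) -> exists a : ringA R, x ^+ j = 1 + a *+ m.
  move=> xm; elim: j => [|j IH]; first by exists 0; rewrite mul0rn addr0.
  by rewrite exprS; apply: mul.
have lift x : (exists a : ringA R, x = 1 + a *+ 2) ->
    exists a, x ^+ (2 ^ k) = 1 + a *+ (2 ^ k).
  (* The induction needs one more factor [2]: the square of [1 + b *+ 2 ^ j] is
     in general [1] modulo [2 ^ j.+1] only for [0 < j]. *)
  move=> x2; suff [a ->] : exists a, x ^+ (2 ^ k) = 1 + a *+ (2 ^ k.+1).
    by exists (a *+ 2); rewrite -mulrnA expnS.
  elim: k => [|j [b IH]]; first exact: x2.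
  exists (b + b ^+ 2 *+ (2 ^ j)).
  rewrite expnSr exprM IH (expnS 2 j.+1) (expnS 2 j).
  rewrite -(mulr_natr b (2 * _)) -(mulr_natr (_ + _) _) -(mulr_natr (b ^+ 2) _) !natrM; ring.
have diff (P P' Q h : C) (t : ringA R) : Q \in ZI -> h \in ZI -> P' * Q = D ->
    val t = P / P' -> P - P' = h *+ 2 -> exists a, t = 1 + a *+ 2.
  move=> QZ hZ PQ tE PP'; have [a aE _] := level_elem 1 (rpredM hZ QZ).
  have Q0 : Q != 0 by apply/eqP => Q0; have := D_neq0 R; rewrite -PQ Q0 mulr0 eqxx.
  have P'0 : P' != 0 by apply/eqP => P0; have := D_neq0 R; rewrite -PQ P0 mul0r eqxx.
  exists a; apply: val_inj; rewrite rmorphD rmorph1 rmorphMn /= aE tE expr1 -PQ.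
  have -> : P = P' + h *+ 2 by rewrite -PP' addrC subrK.
  by field; rewrite P'0 Q0.
have t5 : exists a, theta5 R = 1 + a *+ 2.
  apply: (diff (P5 R) (P5 R)^* (P13 R)^* ('i%C *+ 2)).
  - exact: P13_conj_gaussian.
  - by rewrite rpredMn ?gaussian_i.
  - by [].
  - by [].
  - by apply/eqP; rewrite eq_complex /=; apply/andP; split; apply/eqP; ring.
have t13 : exists a, theta13 R = 1 + a *+ 2.
  apply: (diff (P13 R) (P13 R)^* (P5 R)^* ('i%C *+ 3)).
  - exact: P5_conj_gaussian.
  - by rewrite rpredMn ?gaussian_i.
  - exact: mulrC.
  - by [].
  - by apply/eqP; rewrite eq_complex /=; apply/andP; split; apply/eqP; ring.
by rewrite /thetaX !exprM; apply: mul; apply: pow; apply: lift.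
Qed.

(** There is a [2 ^ k]-torsion character with value [1 / 2 ^ k] at [1]. Since [D]
    divides [65], any [a] in [A] satisfies [65 ^ c * a \in Z[i]] for large [c], and
    replacing [65] by its power [E = 65 ^ (2 ^ k) = 1 mod 2 ^ k] makes
    [Re (E ^ c * a) / 2 ^ k] independent of [c] modulo [1]. *)
Lemma torsion_pow2 k : exists2 u : hatA R,
  u *+ (2 ^ k) = 0 & u (1 : ringA R) = cpi ((2 : R) ^+ k)^-1.
Proof.
pose E : C := (65 ^ (2 ^ k))%N%:R.
have [e eE] : exists e : nat, E = 1 + (2 ^ k * e)%N%:R.
  suff [e eE] : exists e, (65 ^ (2 ^ k) = 1 + 2 ^ k * e)%N.
    by exists e; rewrite /E eE natrD.
  suff [e eE] : exists e, (65 ^ (2 ^ k) = 1 + 2 ^ k.+1 * e)%N.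
    by exists (2 * e)%N; rewrite eE expnSr mulnA.
  elim: k {E} => [|j [e IH]]; first by exists 32%N.
  exists (e + 2 ^ j * e ^ 2)%N.
  rewrite expnSr expnM IH (expnS 2 j.+1) (expnS 2 j); move: (2 ^ j)%N => q; ring.
have EZ c : E ^+ c \in ZI by rewrite rpredX ?rpred_nat.
have Elev a : exists c, E ^+ c * val a \in ZI.
  have [c ca] := level_ex a; exists c.
  have -> : E ^+ c * val a =
      (65 ^ (2 ^ k).-1)%N%:R ^+ c * (P5 R * P13 R) ^+ c * (val a * D ^+ c).
    have -> : E = (65 ^ (2 ^ k).-1)%N%:R * (P5 R * P13 R) * D.
      have -> : (65 ^ (2 ^ k).-1)%N%:R * (P5 R * P13 R) * D =
        (65 ^ (2 ^ k).-1)%N%:R * ((P5 R * (P5 R)^* ) * (P13 R * (P13 R)^* )).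
        by rewrite -[LHS]mulrA; congr (_ * _); exact: mulrACA.
      by rewrite P5PP P13PP -!natrM -expnSr prednK // expn_gt0.
    by rewrite !exprMn; ring.
  apply: rpredM => //; apply: rpredM; apply: rpredX; first exact: rpred_nat.
  by rewrite rpredM ?P5_gaussian ?P13_gaussian.
pose v c a : R := complex.Re (E ^+ c * val a) / 2 ^+ k.
have vmono c c' a : (c <= c')%N -> E ^+ c * val a \in ZI -> cpi (v c' a) = cpi (v c a).
  move=> cc' aZ; apply/cpi_eq.
  have [h hZ hE] : exists2 h, h \in ZI & E ^+ (c' - c) = 1 + (2 ^ k)%N%:R * h.
    elim: (c' - c)%N => [|j [h hZ IH]]; first by exists 0; rewrite ?rpred0 // mulr0 addr0.
    exists (h + e%:R + (2 ^ k)%N%:R * h * e%:R).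
      by rewrite !rpredD ?rpredM ?rpred_nat.
    by rewrite exprSr IH eE natrM; ring.
  have /andP[/intrP[n nE] _] : h * (E ^+ c * val a) \in ZI by rewrite rpredM.
  exists n; rewrite /v -(subnKC cc') exprD hE mulrAC mulrDr mulr1 raddfD /= mulrDl.
  congr (_ + _); rewrite [_ * (_ * h)]mulrC -mulrA -nE.
  rewrite -(rmorph_nat (@real_complex_def R (Phant R))).
  case: (h * _) => x y /=; rewrite mul0r subr0 natrX mulrC mulKf //.
pose ca a := sval (cid (Elev a)).
have caP a : E ^+ ca a * val a \in ZI := svalP (cid (Elev a)).
pose f a : circle R := cpi (v (ca a) a).
have fE c a : E ^+ c * val a \in ZI -> f a = cpi (v c a).
  move=> aZ; rewrite /f.
  by have [le|/ltnW le] := leqP c (ca a); [|symmetry]; apply: vmono.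
have fB : zmod_morphism f.
  move=> a b; pose c := (ca a + ca b)%N.
  have aZ : E ^+ c * val a \in ZI by rewrite /c addnC exprD -mulrA rpredM.
  have bZ : E ^+ c * val b \in ZI by rewrite /c exprD -mulrA rpredM.
  rewrite (fE c a) // (fE c b) // (fE c (a - b)); last by rewrite rmorphB mulrBr rpredB.
  by rewrite /v rmorphB /= mulrBr raddfB /= mulrBl cpiB.
pose u : hatA R := HB.pack f (GRing.isZmodMorphism.Build _ _ _ fB).
exists u.
  apply: hatA_ext => a; rewrite hatAMnE hatA0E -[u a]/(f a) /f -raddfMn; apply/cpi_eq0.
  rewrite -mulr_natr natrX /v divfK ?expf_neq0 ?pnatr_eq0 //.
  by have /andP[] := caP a.
by rewrite -[u 1]/(f 1) (fE 0%N) ?expr0 ?mul1r ?rpred1 // /v expr0 !mul1r.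
Qed.
End Torsion.

(** * Torsion lines *)

Section TorsionLines.
Local Open Scope complex_scope.
Local Open Scope quotient_scope.
Local Open Scope ring_scope.
Variable R : realType.
Local Notation C := R[i].
Local Notation "'ZI'" := (@gaussian R).
Local Notation cnorm := (@Normc.normc R).
Local Notation cpi := (\pi_(circle R)).
Local Notation D := (Dbar R).
Implicit Types (a b t : ringA R) (w chi psi u : hatA R) (z : C) (c : nat).

(** The points of [torsion + jC C], characterized as those that some nonzero
    element of [A] maps into the line [jC C]. *)
Definition on_torsion_line chi : Prop := exists a z, a != 0 /\ act a chi = jC z.

Lemma ringA_mul_neq0 a b : a != 0 -> b != 0 -> a * b != 0.
Proof.
rewrite -!(inj_eq val_inj) !(rmorph0 (val : ringA R -> C)) => a0 b0.
have -> : val (a * b) = val a * val b by exact: rmorphM.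
exact: mulf_neq0.
Qed.

Lemma on_torsion_lineD chi z : on_torsion_line chi -> on_torsion_line (chi + jC z).
Proof.
move=> [a [z' [a0 E]]]; exists a, (z' + z * val a); split=> //.
by rewrite actD E act_jC jCD.
Qed.

Lemma on_torsion_line_act t chi : t != 0 ->
  on_torsion_line (act t chi) -> on_torsion_line chi.
Proof.
move=> t0 [a [z [a0 E]]]; exists (a * t), z; split; first exact: ringA_mul_neq0.
by rewrite act_mul.
Qed.

Lemma act_nat n chi : act n%:R chi = chi *+ n.
Proof. by apply: hatA_ext => a; rewrite actE hatAMnE mulr_natl raddfMn. Qed.

Lemma gaussian_conj (g : C) : g \in ZI -> g^* \in ZI.
Proof. by case: g => x y /andP[/= xZ yZ]; rewrite unfold_in /= xZ rpredN. Qed.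

Lemma torsion_lineP chi : on_torsion_line chi ->
  exists u n z, [/\ (0 < n)%N, u *+ n = 0 & chi = u + jC z].
Proof.
move=> [a [z [a0 E]]].
have va0 : val a != 0 by rewrite -(rmorph0 (val : ringA R -> C)) (inj_eq val_inj).
have [c ca] := level_ex a; have [n nE] := gaussian_norm ca.
have Dc0 : D ^+ c != 0 by apply: expf_neq0; apply: D_neq0.
set g := val a * D ^+ c in nE.
have g0 : g != 0 by rewrite mulf_neq0.
have gJ : g^* \in ZI by exact: gaussian_conj.
have [t tE] : exists t, val t = D ^+ c * g^*.
  by apply: gaussian_elem; rewrite rpredM ?rpredX ?D_gaussian.
exists (chi - jC (z / val a)), n, (z / val a); split; last by rewrite subrK.
  by rewrite lt0n -(eqr_nat C) -nE mulf_neq0 // conjC_eq0.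
rewrite -act_nat; have -> : n%:R = t * a.
  apply: val_inj; rewrite rmorph_nat -nE.
  have -> : val (t * a) = val t * val a by exact: rmorphM.
  by rewrite tE /g; ring.
rewrite act_mul actB E act_jC divfK // subrr.
by apply: hatA_ext => b; rewrite actE !hatA0E.
Qed.

Lemma cnorm_gaussian_ge1 (g : C) : g \in ZI -> g != 0 -> 1 <= cnorm g.
Proof.
move=> gZ g0; have [n nE] := gaussian_norm gZ.
have n0 : (0 < n)%N by rewrite lt0n -(eqr_nat C) -nE mulf_neq0 // conjC_eq0.
have E : cnorm g ^+ 2 = n%:R by rewrite -cnorm_nat -nE cnormM cnorm_conj expr2.
by rewrite -(@ler_pXn2r _ 2) ?nnegrE ?cnorm_ge0 // expr1n E ler1n.
Qed.

Lemma cnorm_DX_large (B : R) : exists c, B < cnorm (D ^+ c).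
Proof.
have D2 : 2 <= cnorm D.
  rewrite -(@ler_pXn2r _ 2) ?nnegrE ?cnorm_ge0 ?ler0n //.
  have -> : cnorm D ^+ 2 = 5 * 13.
    rewrite -(cnorm_nat R 5) -(cnorm_nat R 13) -P5PP -P13PP DbarE !cnormM !cnorm_conj.
    by ring.
  by rewrite -natrX -natrM ler_nat.
exists (Num.bound `|B|); apply: le_lt_trans (ler_norm _) _.
apply: lt_le_trans (archi_boundP (normr_ge0 B)) _; rewrite cnormX.
apply: le_trans (_ : 2 ^+ Num.bound `|B| <= _); last first.
  by rewrite lerXn2r ?nnegrE ?cnorm_ge0 ?ler0n.
by rewrite -natrX ler_nat ltnW // ltn_expl.
Qed.

(** A limit of points of the disc agrees on each lattice with a point of a slightly
    larger disc, which is the same at all levels deep enough to separate that disc. *)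
Lemma closed_disc (rho : R) : closed [set chi | exists2 z, cnorm z <= rho & chi = jC z].
Proof.
move=> chi cl.
have app c e : 0 < e -> exists2 z, cnorm z < rho + e & agree c chi z.
  move=> e0; have : nbhs chi [set psi | near0 c e (psi - chi)].
    by apply/nbhs_hatAP; exists c, e.
  move=> /cl[_ [[z zr ->] [z' z'e H]]]; exists (z - z').
    by apply: le_lt_trans (cnormD _ _) _; rewrite cnormN; apply: ler_ltD.
  by move=> a /H; rewrite hatABE jCB hatABE => <-; rewrite opprB addrC subrK.
have [c0 c0P] := cnorm_DX_large (2 * (rho + 1)).
have [w w1 wP] := app c0 1 ltr01.
have uniq c e z : 0 < e -> e <= 1 -> (c0 <= c)%N -> cnorm z < rho + e ->
    agree c chi z -> z = w.
  move=> e0 e1 cc ze H; have : gdvd (D ^+ c0) (z - w).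
    by apply/agree_gdvd => a ca; rewrite -(wP a ca) -(agree_mono cc H).
  move=> [h hZ E]; apply/eqP; rewrite -subr_eq0 E; apply: contraTT c0P => Dh.
  have h0 : h != 0 by apply: contraNneq Dh => ->; rewrite mulr0.
  rewrite -leNgt; apply: le_trans (_ : cnorm (z - w) <= _).
    rewrite E cnormM ler_peMr ?cnorm_ge0 //; exact: cnorm_gaussian_ge1.
  by apply: le_trans (cnormD _ _) _; rewrite cnormN; lra.
exists w.
  apply/ler_addgt0Pr => e e0; pose e' := Num.min e 1.
  have e'0 : 0 < e' by rewrite lt_min e0 ltr01.
  have [z ze H] := app c0 e' e'0.
  rewrite -(uniq c0 e' z) ?ge_min ?lexx ?orbT //; apply/ltW/(lt_le_trans ze).
  by rewrite lerD2l ge_min lexx.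
apply: hatA_ext => a; have [c ca] := level_ex a.
have [z z1 H] := app (maxn c0 c) 1 ltr01.
rewrite (H a); last by apply: level_mono ca; rewrite leq_maxr.
by rewrite (uniq (maxn c0 c) 1 z) ?leq_maxl.
Qed.

Lemma closed_diff (Y Z : set (hatA R)) : closed Y -> closed Z ->
  closed [set q | exists y z : hatA R, [/\ Y y, Z z & q = y - z]].
Proof.
move=> cY cZ.
have -> : [set q | exists y z : hatA R, [/\ Y y, Z z & q = y - z]] =
    (fun p : hatA R * hatA R => p.1 - p.2) @` (Y `*` Z).
  rewrite eqEsubset; split=> [q [y [z [Yy Zz ->]]]|_ [[y z] [/= Yy Zz] <-]].
    by exists (y, z).
  by exists y, z.
apply: compact_closed; first exact: hausdorff_hatA.
apply: continuous_compact.
  apply: continuous_subspaceT => -[x y] U /nbhs_hatAP[c [e [e0 eU]]].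
  have e2 : 0 < e / 2 by rewrite divr_gt0.
  exists ([set psi | near0 c (e / 2) (psi - x)], [set psi | near0 c (e / 2) (psi - y)]).
    by split; apply/nbhs_hatAP; exists c, (e / 2).
  move=> [x' y'] [/= [z ze zP] [z' z'e z'P]]; apply: eU; exists (z - z').
    by apply: le_lt_trans (cnormD _ _) _; rewrite cnormN; lra.
  have -> : x' - y' - (x - y) = (x' - x) - (y' - y) 
    by rewrite !opprB addrACA [RHS]addrACA [- x - _]addrC.
  exact: agreeB.
apply: compact_setX; first by apply: (subclosed_compact cY (@compact_hatA R)).
by apply: (subclosed_compact cZ (@compact_hatA R)).
Qed.

(** The affine self-maps of the dual that occur below are continuous. *)
Lemma continuous_act_shift t u : continuous (fun chi => act t chi + u).
Proof.
move=> chi U /nbhs_hatAP[c [e [e0 eU]]].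
have [c' c'P] := level_ex t.
apply/nbhs_hatAP; exists (c + c')%N, (e / (cnorm (val t) + 1)).
have n0 : 0 < cnorm (val t) + 1 by rewrite ltr_wpDl ?cnorm_ge0.
split=> [|psi [z ze zP]]; first by rewrite divr_gt0.
apply: eU; exists (z * val t).
  have a0 := cnorm_ge0 (val t); have z0 := cnorm_ge0 z.
  rewrite cnormM; rewrite ltr_pdivlMr // in ze; nra.
have -> : act t psi + u - (act t chi + u) = act t (psi - chi).
  by rewrite opprD addrACA subrr addr0 actB.
rewrite -[agree _ _ _]/(agree _ _ (z * val t)) => a ca.
rewrite actE zP -?act_jC //.
rewrite /level (_ : val (t * a) = val t * val a); last exact: rmorphM.
by rewrite exprD [D ^+ c * _]mulrC mulrACA; apply: rpredM.
Qed.

Lemma closed_act_shift t u (Y : set (hatA R)) : closed Y ->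
  closed [set chi | Y (act t chi + u)].
Proof.
by move=> cY; apply: (closed_comp _ cY) => chi _; apply: continuous_act_shift.
Qed.

Lemma thetaX5_neq m m' : (m < m')%N -> thetaX R m' 0 - thetaX R m 0 != 0.
Proof.
move=> mm'; rewrite subr_eq0; apply/eqP => E.
have : val (thetaX R m' 0) = val (thetaX R m 0) by rewrite E.
rewrite !val_thetaX !expr0 !mulr1 -(subnKC (ltnW mm')) exprD.
rewrite -[RHS]mulr1 => /mulfI; rewrite expf_neq0 ?mulf_neq0 ?P5_neq0 ?invr_eq0 ?P5_conj_neq0 //.
move=> /(_ isT)/eqP; rewrite expr_div_n -[X in _ == X](divff (x := (P5 R)^* ^+ (m' - m))).
  rewrite (inj_eq (mulIf _)); first by apply/negP/P5X_neq; rewrite subn_gt0.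
  by rewrite invr_eq0 expf_neq0 ?P5_conj_neq0.
by rewrite expf_neq0 ?P5_conj_neq0.
Qed.

Lemma rotation_infinite M : (0 < M)%N -> (P5 R / (P5 R)^*) ^+ M != 1.
Proof.
move=> M0; have := thetaX5_neq M0; apply: contraNneq => E.
by rewrite subr_eq0; apply/eqP/val_inj; rewrite !val_thetaX !expr0 !mulr1.
Qed.

Lemma Theta_thetaX_invariant N (Y : set (hatA R)) : Theta_invariant Y -> thetaX_invariant N Y.
Proof. by move=> iY r s chi; apply: iY; exists (N * r)%N, (N * s)%N. Qed.

(** A nonempty closed invariant set without points of [torsion + jC C] contains,
    for every [2 ^ k]-torsion point [u], progressions [x, x + u, x + 2 u, ...] of
    any length. Indeed the differences of any such set [W] accumulate at [0] off the
    line, along an orbit, hence exhaust the dual; so [W] contains two points that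
    differ by [u], and the [x] in [W] with [x + u] in [W] form a set of the same
    kind. *)
Lemma torsion_progression k (Z : set (hatA R)) u n : closed Z -> thetaX_invariant (2 ^ k) Z ->
  Z !=set0 -> (forall chi, Z chi -> ~ on_torsion_line chi) -> u *+ (2 ^ k) = 0 ->
  exists x, forall j, (j <= n)%N -> Z (x + u *+ j).
Proof.
move=> cZ iZ Z0 ZT uk; set N := (2 ^ k)%N in iZ uk.
have N0 : (0 < N)%N by rewrite expn_gt0.
suff [W [_ _ [x Wx] WZ]] : exists W : set (hatA R), [/\ closed W, thetaX_invariant N W, W !=set0 &
    forall x, W x -> forall j, (j <= n)%N -> Z (x + u *+ j)] by exists x; apply: WZ.
elim: n => [|n [W [cW iW [x0 Wx0] WZ]]].
  by exists Z; split=> // x Zx [|//] _; rewrite mulr0n addr0.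
pose Q := [set q | exists y x : hatA R, [/\ W y, W x & q = y - x]].
have Qfull : forall q, Q q.
  apply: (@invariant_full R N) => //; first exact: closed_diff.
    move=> r s _ [y [x [Wy Wx ->]]]; rewrite actB.
    exists (act (thetaX R (N * r) (N * s)) y), (act (thetaX R (N * r) (N * s)) x).
    by split=> //; apply: iW.
  move=> c e e0; have [b1 b1E _] := level_elem c (rpred1 (@gaussian R)).
  have [b2 b2E _] := level_elem c (gaussian_i R).
  have rep (y : circle R) : {r : R | y = cpi r & 0 <= r < 1}.
    apply: cid2; have [r rE] := cpi_surj y; exists (r - (Num.floor r)%:~R).
      by rewrite rE; apply/cpi_eq; exists (Num.floor r); rewrite subrK.
    have := floor_itv r; rewrite rmorphD /= => /andP[]; lra.
  pose x j := act (thetaX R (N * j) (N * 0)) x0.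
  have Dc0 : 0 < cnorm (D ^+ c) by apply/cnorm_gt0/expf_neq0/D_neq0.
  pose d := e / 2 / cnorm (D ^+ c); have d0 : 0 < d by rewrite !divr_gt0.
  pose f b j := s2val (rep (x j b)).
  have fE b j : x j b = cpi (f b j) := s2valP (rep (x j b)).
  have f01 b j : 0 <= f b j < 1 := s2valP' (rep (x j b)).
  have [j [j' [jj' h1 h2]]] := pigeonhole_square d0 (f01 b1) (f01 b2).
  (* [x j'] and [x j] are close at level [c]; were their difference on the line, [x0]
     would be mapped into the line by [theta5 ^+ (N * j') - theta5 ^+ (N * j)]. *)
  exists (x j' - x j); split.
  - by exists (x j'), (x j); split=> //; apply: iW.
  - exists (((f b1 j' - f b1 j) +i* (- (f b2 j' - f b2 j))) * D ^+ c).
      rewrite cnormM -ltr_pdivlMr //; apply: le_lt_trans (cnorm_ReIm _ _) _.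
      by rewrite normrN; apply: lt_le_trans (ltrD h1 h2) _; rewrite /d; lra.
    by apply: (agree_lift b1E b2E); rewrite hatABE !fE -cpiB.
  - move=> z E; apply: (ZT x0); first by have := WZ _ Wx0 0%N isT; rewrite mulr0n addr0.
    exists (thetaX R (N * j') 0 - thetaX R (N * j) 0), z; split.
      by apply: thetaX5_neq; rewrite ltn_pmul2l.
    rewrite -E /x muln0; apply: hatA_ext => a.
    by rewrite hatABE !actE mulrBl raddfB.
exists (W `&` [set x | W (x + u)]); split.
- apply: closedI => //; have := @closed_act_shift 1 u W cW.
  by under eq_set => y do rewrite act1.
- move=> r s y [Wy Wyu]; split; first exact: iW.
  have [a aE] := thetaX_pow2 R k r s.
  have fu : act (thetaX R (N * r) (N * s)) u = u by rewrite (act_torsion uk aE) act1.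
  by have := iW r s _ Wyu; rewrite actD fu.
- have [y [x [Wy Wx E]]] := Qfull u; exists x; split=> //=.
  by rewrite E addrC subrK.
- move=> x [Wx Wxu] [|j] jn; first exact: (WZ x Wx).
  by rewrite mulrS addrA; apply: WZ.
Qed.
End TorsionLines.

(** * Orbits that avoid an arc *)

Section Main.
Local Open Scope complex_scope.
Local Open Scope quotient_scope.
Local Open Scope ring_scope.
Variable R : realType.
Local Notation C := R[i].
Local Notation "'ZI'" := (@gaussian R).
Local Notation cnorm := (@Normc.normc R).
Local Notation cpi := (\pi_(circle R)).
Implicit Types (a b t : ringA R) (w chi psi u : hatA R) (z : C) (c : nat).

Lemma dyadic_dense (e : R) : 0 < e -> exists k, forall x : R, exists j (m : int),
  (j <= 2 ^ k)%N /\ `|j%:R / 2 ^+ k - x - m%:~R| < e.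
Proof.
move=> e0; pose k := Num.bound e^-1; exists k => x.
have k2 : 0 < 2 ^+ k :> R by rewrite exprn_gt0.
have ke : (2 ^+ k)^-1 < e.
  rewrite invf_plt ?posrE //; apply: lt_trans (archi_boundP _) _.
    by rewrite invr_ge0 ltW.
  by rewrite -natrX ltr_nat ltn_expl.
pose y := x - (Num.floor x)%:~R.
have /andP[y0 y1] : 0 <= y < 1.
  by have := floor_itv x; rewrite rmorphD /= /y => /andP[]; lra.
have yk0 : 0 <= y * 2 ^+ k by rewrite mulr_ge0 // ltW.
have /andP[t1 t2] := Num.Theory.truncn_itv yk0; set j := Num.truncn _ in t1 t2.
exists j, (- Num.floor x); split.
  rewrite -(ler_nat R) natrX; apply: le_trans t1 _.
  by rewrite -[leRHS]mul1r ler_pM2r // ltW.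
have -> : j%:R / 2 ^+ k - x - (- Num.floor x)%:~R = (j%:R - y * 2 ^+ k) / 2 ^+ k.
  by rewrite mulrBl mulfK ?gt_eqF // /y rmorphN /=; ring.
apply: le_lt_trans ke; rewrite normrM normfV (gtr0_norm k2) -[leRHS]mul1r.
rewrite -natr1 in t2; rewrite ler_wpM2r ?invr_ge0 ?(ltW k2) // ler_norml.
by apply/andP; split; lra.
Qed.

(** The set [Y(1)] of values at [1] meets the open arc of radius [e] around [p]. *)
Definition hits (Y : set (hatA R)) (p : circle R) (e : R) : Prop :=
  exists y r, [/\ Y y, `|r| < e & y (1 : ringA R) = p + cpi r].

Lemma hatA1_jC z : jC z (1 : ringA R) = cpi (complex.Re z).
Proof. by rewrite jCE (_ : val (1 : ringA R) = 1) ?mulr1 // rmorph1. Qed.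

(** If [Y] accumulates off the line at a point [u + jC z] with [u] torsion, then
    [Y(1)] is dense. Let [u' = act t0 u] be fixed by [N]-th powers. The set [Q] of
    [x] such that [act t0 x + u'] belongs to [Y] up to a point of the disc of radius
    [|z|] is closed, invariant under [N']-th powers, and accumulates at [0] off the
    line, so it is the whole dual. Hence [Y] contains a point
    [uk *+ j + u' + jC z'] for each [2 ^ k]-torsion point [uk *+ j], and rotating
    [z'] makes its real part negligible. *)
Lemma accumulation_hits (Y : set (hatA R)) u n z : closed Y -> Theta_invariant Y ->
  (0 < n)%N -> u *+ n = 0 ->
  (forall c e, 0 < e -> exists y, [/\ Y y, near0 c e (y - (u + jC z)) &
     forall z', y - (u + jC z) <> jC z']) ->
  forall p e, 0 < e -> hits Y p e.
Proof.
move=> cY iY n0 un acc p e e0; have e2 : 0 < e / 2 by rewrite divr_gt0.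
have [r0 [s0 [N [N0 fixN]]]] := torsion_fixed n0 un.
set t0 := thetaX R r0 s0 in fixN; set u' := act t0 u in fixN.
have [k dy] := dyadic_dense e2; have [uk ukt uk1] := torsion_pow2 R k.
pose N' := (N * 2 ^ k)%N; have N'0 : (0 < N')%N by rewrite muln_gt0 N0 expn_gt0.
have fixN' r s : act (thetaX R (N' * r) (N' * s)) u' = u'.
  by rewrite /N' -!mulnA; apply: fixN.
pose disc := [set chi | exists2 z', cnorm z' <= cnorm z & chi = jC z'].
pose Q := [set x | exists y d : hatA R, [/\ Y y, disc d & act t0 x + u' = y - d]].
have Qfull x : Q x.
  apply: (@invariant_full R N') => //.
  - have cQ := closed_diff cY (@closed_disc R (cnorm z)).
    exact: (@closed_act_shift R t0 u' _ cQ).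
  - move=> r s {}x [y [_ [Yy [z' z'z ->] E]]]; set t := thetaX R _ _.
    exists (act t y), (jC (z' * val t)); split; first exact: Theta_thetaX_invariant.
      by exists (z' * val t) => //; rewrite cnormM cnorm_thetaX mulr1.
    rewrite -act_mul mulrC act_mul -{1}(fixN' r s) -actD E actB act_jC //.
  - move=> c d d0; have [y [Yy near nline]] := acc c d d0.
    exists (y - (u + jC z)); split=> //.
    exists (act t0 y), (jC (z * val t0)); split; first by apply: iY => //; exists r0, s0.
      by exists (z * val t0) => //; rewrite cnormM cnorm_thetaX mulr1.
    by rewrite actB actD act_jC opprD addrA -/u' addrAC subrK.
have [v vE] := cpi_surj (p - u' 1); have [j [m [_ jv]]] := dy v.
have ukjt : uk *+ j *+ 2 ^ k = 0 by rewrite -mulrnA mulnC mulrnA ukt mul0rn.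
(* The point [x] is chosen so that [act t0 x = uk *+ j]. *)
have [y [_ [Yy [z' z'z ->] E]]] :=
  Qfull (act (thetaX R (2 ^ k * r0 - r0) (2 ^ k * s0 - s0)) (uk *+ j)).
move: E; rewrite -act_mul thetaXM !subnKC ?leq_pmull ?expn_gt0 //.
have fixk r s : act (thetaX R (2 ^ k * r) (2 ^ k * s)) (uk *+ j) = uk *+ j.
  by have [a aE] := thetaX_pow2 R k r s; rewrite (act_torsion ukjt aE) act1.
rewrite fixk => E.
have [l lP] : exists l, `|complex.Re (((P5 R / (P5 R)^*) ^+ N') ^+ l * z') - 0| < e / 2.
  apply: rotation_Re_dense => //.
  - by rewrite cnormX cnorm_rot ?P5_neq0 // expr1n.
  - by move=> M M0; rewrite -exprM rotation_infinite // muln_gt0 N'0.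
  - by rewrite normr0 cnorm_ge0.
set t := thetaX R (N' * l) (N' * 0).
have tv : val t = ((P5 R / (P5 R)^*) ^+ N') ^+ l by rewrite val_thetaX muln0 expr0 mulr1 exprM.
pose rho := complex.Re (z' * val t).
exists (act t y), (j%:R / 2 ^+ k - v - m%:~R + rho); split.
- exact: Theta_thetaX_invariant.
- apply: le_lt_trans (ler_normD _ _) _; rewrite subr0 -tv mulrC -/rho in lP; lra.
have -> : act t y = uk *+ j + u' + jC (z' * val t).
  rewrite -act_jC -[y](subrK (jC z')) -E !actD fixN'; congr (_ + _ + _).
  by rewrite /t /N' [(N * _)%N]mulnC -!mulnA fixk.
have -> : p = u' 1 + cpi v by rewrite -vE addrC subrK.
rewrite !hatADE hatAMnE uk1 hatA1_jC -/rho -raddfMn -addrA -[RHS]addrA.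
rewrite [LHS]addrC -addrA; congr (_ + _); rewrite -!cpiD; apply/cpi_eq; exists m.
rewrite -mulr_natl; ring.
Qed.

Section Gap.
Variables (Y : set (hatA R)) (p : circle R) (e : R).
Hypotheses (cY : closed Y) (iY : Theta_invariant Y) (e0 : 0 < e) (gap : ~ hits Y p e).

(** The orbit closure of [y] meets [torsion + jC C], since otherwise
    [torsion_progression] makes [Y(1)] dense; unless [y] itself belongs to
    [torsion + jC C], its orbit accumulates there off the line. *)
Lemma all_on_torsion_lines y : Y y -> on_torsion_line y.
Proof.
move=> Yy; apply: contrapT => yT.
pose O := [set act t y | t in @Theta R]; pose Z := closure O.
have OY : O `<=` Y by move=> _ [t tT <-]; apply: iY.
have ZY : Z `<=` Y by rewrite [Y](iffLR (closure_id Y)) //; apply: closureS.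
have OT chi : O chi -> ~ on_torsion_line chi.
  by move=> [_ [r [s ->]] <-] /(on_torsion_line_act (thetaX_neq0 R r s)).
have iZ k : thetaX_invariant k Z.
  move=> r s chi Zchi U Uchi.
  pose f (psi : hatA R) := act (thetaX R (k * r) (k * s)) psi + 0.
  have [|_ [[_ [r' [s' ->]] <-] OU]] := Zchi (f @^-1` U).
    by apply: (@continuous_act_shift R (thetaX R (k * r) (k * s)) 0); rewrite addr0.
  exists (act (thetaX R (k * r) (k * s)) (act (thetaX R r' s') y)); split.
    rewrite -act_mul thetaXM; exists (thetaX R (k * r + r') (k * s + s')) => //.
    by exists (k * r + r')%N, (k * s + s')%N.
  by move: OU; rewrite /preimage /f /= addr0.
have [[v [Zv vT]]|ZT] := pselect (exists v, Z v /\ on_torsion_line v).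
  have [u [n [z [n0 un vE]]]] := torsion_lineP vT.
  apply: gap; apply: (accumulation_hits (u := u) (n := n) (z := z) cY iY) => // c d d0.
  have : nbhs v [set psi | near0 c d (psi - v)] by apply/nbhs_hatAP; exists c, d.
  move=> /Zv[x [Ox nx]]; rewrite -vE; exists x; split=> //; first exact: OY.
  move=> z' E; apply: (OT x Ox); rewrite -(subrK v x) E addrC.
  exact: on_torsion_lineD.
have [k dy] := dyadic_dense e0; have [uk ukt uk1] := torsion_pow2 R k.
have [||chi xP] := @torsion_progression R k Z uk (2 ^ k) (@closed_closure _ O) (iZ _) _ _ ukt.
- exists y; apply: subset_closure; exists 1; rewrite ?act1 //.
  by exists 0%N, 0%N; rewrite -/(thetaX R 0 0) thetaX00.
- by move=> v Zv vT; apply: ZT; exists v.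
have [v vE] := cpi_surj (p - chi 1); have [j [m [jk jv]]] := dy v.
apply: gap; exists (chi + uk *+ j), (j%:R / 2 ^+ k - v - m%:~R); split=> //.
  by apply: ZY; apply: xP.
have -> : p = chi 1 + cpi v by rewrite -vE addrC subrK.
rewrite hatADE hatAMnE uk1 -raddfMn -[RHS]addrA -cpiD; congr (_ + _); apply/cpi_eq.
by exists m; rewrite -mulr_natl; ring.
Qed.

(** Otherwise rotating [z] would sweep an arc of length at least [1] around [u' 1],
    for a fixed image [u'] of [u]. *)
Lemma radius_le_half u z : torsion u -> Y (u + jC z) -> cnorm z <= 2^-1.
Proof.
move=> [n n0 un] Yy; rewrite leNgt; apply/negP => zh; apply: gap.
have [r0 [s0 [N [N0 fixN]]]] := torsion_fixed n0 un.
set t0 := thetaX R r0 s0 in fixN; set u' := act t0 u in fixN.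
have [x xE] := cpi_surj (p - u' 1); pose v := x - (Num.floor (x + 2^-1))%:~R.
have vh : `|v| <= 2^-1.
  have := floor_itv (x + 2^-1); rewrite rmorphD /= /v ler_norml => /andP[h1 h2].
  by apply/andP; split; lra.
have [l lP] : exists l, `|complex.Re (((P5 R / (P5 R)^*) ^+ N) ^+ l * (z * val t0)) - v| < e.
  apply: rotation_Re_dense => //.
  - by rewrite cnormX cnorm_rot ?P5_neq0 // expr1n.
  - by move=> M M0; rewrite -exprM rotation_infinite // muln_gt0 N0.
  - by rewrite cnormM cnorm_thetaX mulr1 (le_trans vh) // ltW.
set t := thetaX R (N * l) (N * 0).
have tv : val t = ((P5 R / (P5 R)^*) ^+ N) ^+ l by rewrite val_thetaX muln0 expr0 mulr1 exprM.
exists (act t (act t0 (u + jC z))), (complex.Re (z * val t0 * val t) - v); split.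
- by apply: (Theta_thetaX_invariant N iY); apply: iY => //; exists r0, s0.
- by rewrite mulrC tv.
have -> : p = u' 1 + cpi x by rewrite -xE addrC subrK.
rewrite !actD !act_jC -/u' fixN hatADE hatA1_jC -[RHS]addrA -cpiD; congr (_ + _).
by apply/cpi_eq; exists (- Num.floor (x + 2^-1)); rewrite rmorphN /= /v; ring.
Qed.
End Gap.

(** A base point, as required by the covering form of compactness. *)
HB.instance Definition _ := isPointed.Build (hatA R) 0.

(** Each point of [Y] has a neighborhood in which [Y] stays on one line, by
    [accumulation_hits]; finitely many of these cover [Y]. *)
Lemma finite_torsion_cover (Y : set (hatA R)) :
  closed Y -> Theta_invariant Y -> [set chi (1 : ringA R) | chi in Y] <> [set: circle R] ->
  exists (k : nat) (u : 'I_k -> hatA R), (forall i, torsion (u i)) /\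
    Y `<=` \bigcup_(i in [set: 'I_k]) cballC (2^-1 : R) (u i).
Proof.
move=> cY iY Y1.
have coY : compact Y by apply: (subclosed_compact cY (@compact_hatA R)).
have [p [e [e0 gap]]] : exists p e, 0 < e /\ ~ hits Y p e.
  pose ev1 (chi : hatA R) : circle R := chi (1 : ringA R).
  have cY1 : closed (ev1 @` Y).
    apply: compact_closed; first exact: hausdorff_circle.
    apply: continuous_compact coY; apply: continuous_subspaceT.
    exact: continuous_eval.
  have [p Np] : exists p : circle R, ~ (ev1 @` Y) p.
    apply: contrapT => H; apply: Y1; rewrite eqEsubset; split=> // p _.
    by apply: contrapT => Np; apply: H; exists p.
  have [x xE] := cpi_surj p.
  have : nbhs (cpi x) (~` (ev1 @` Y)).
    by apply: open_nbhs_nbhs; split; [exact: closed_openC|rewrite -xE].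
  move=> /nbhs_circleP[e e0 eP]; exists p, e; split=> // -[y [r [Yy re yE]]].
  by apply: (eP r re); exists y; rewrite // /ev1 yE xE cpiD.
have [T TP] : exists T : hatA R -> hatA R,
    forall y, Y y -> torsion (T y) /\ exists z, y = T y + jC z.
  have ex y : exists u, Y y -> torsion u /\ exists z, y = u + jC z.
    have [Yy|nY] := pselect (Y y); last by exists 0.
    have [u [n [z [n0 un yE]]]] := torsion_lineP (all_on_torsion_lines cY iY e0 gap Yy).
    by exists u => _; split; [exists n|exists z].
  by exists (fun y => sval (cid (ex y))) => y; apply: (svalP (cid (ex y))).
pose V y := interior [set y' | Y y' -> exists z, y' - y = jC z].
have YV : Y `<=` \bigcup_(y in Y) V y.
  move=> y Yy; exists y => //; rewrite /V /interior /=.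
  have [[n n0 un] [z yE]] := TP y Yy.
  apply: contrapT => NV; apply: gap.
  apply: (accumulation_hits (u := T y) (n := n) (z := z) cY iY) => // c d d0.
  rewrite -yE; apply: contrapT => H; apply: NV; apply/nbhs_hatAP; exists c, d; split=> //.
  move=> y' ny' /= Yy'; apply: contrapT => H'; apply: H; exists y'; split=> // z' E.
  by apply: H'; exists z'.
have := coY; rewrite compact_cover => /(_ _ Y V (fun y _ => open_interior _) YV).
move=> [F FY YF]; pose s := enum_fset F.
have sY y : y \in s -> Y y by move=> /FY/set_mem.
exists (size s), (fun i => T (nth 0 s i)); split.
  by move=> i; have [] := TP _ (sY _ (mem_nth 0 (ltn_ord i))).
move=> y Yy; have [y0 /= y0F Vy] := YF y Yy.
have ys : (index y0 s < size s)%N by rewrite index_mem.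
exists (Ordinal ys) => //=; rewrite nth_index //.
have [Ty0 [z0 y0E]] := TP _ (sY _ y0F).
have [z zE] := interior_subset Vy Yy.
have yE : y = T y0 + jC (z0 + z).
  by rewrite jCD addrA -y0E -zE addrC subrK.
exists (z0 + z); last by rewrite yE.
rewrite /= cnormE lecR; apply: (radius_le_half iY e0 gap Ty0).
by rewrite -yE.
Qed.
End Main.

Unset Implicit Arguments.

Theorem lemma5p3 (R : realType) (Y : set (hatA R))
    (Y_closed : closed Y) (Y_inv : Theta_invariant Y)
    (Y1 : [set chi (1 : ringA R) | chi in Y] <> [set: circle R]) :
  exists (k : nat) (u : 'I_k -> hatA R),
    (forall i, torsion (u i)) /\
    Y `<=` \bigcup_(i in [set: 'I_k]) cballC (2^-1 : R) (u i).
Proof. exact: finite_torsion_cover. Qed.
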